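(* Every Finsler manifold $(M,L)$ of constant curvature $k$ and of dimension $n\ge4$ is a Finsler manifold of $H_p$-constant curvature $\varepsilon=k$.
   Context: Pullback formalism. $M$ is a smooth $n$-dimensional manifold, $\pi:\mathcal{T}M\to M$ the bundle of nonzero tangent vectors, $\pi^{-1}(TM)\to\mathcal{T}M$ the pullback of $TM$. Sections of $\pi^{-1}(TM)$ are called $\pi$-vector fields (written with bars), tensor fields on $\pi^{-1}(TM)$ are called $\pi$-tensor fields, and $\overline{\eta}(u)=(u,u)$ is the fundamental $\pi$-vector field. There is an exact sequence $0\to\pi^{-1}(TM)\xrightarrow{\gamma}T(\mathcal{T}M)\xrightarrow{\rho}\pi^{-1}(TM)\to0$, with $\rho=(\pi_{\mathcal{T}M},\pi_* )$ (where $\pi_{\mathcal{T}M}:T(\mathcal{T}M)\to\mathcal{T}M$ is the projection) and $\gamma$ the vertical lift. A connection $D$ on $\pi^{-1}(TM)$ is regular if $T_u(\mathcal{T}M)=V_u\oplus H_u$ for all $u$, where $V_u$ is the vertical space and $H_u=\{X: D_X\overline{\eta}=0\}$; its horizontal map is $\beta=(\rho|_{H})^{-1}$. Torsion and curvature (note the sign convention) are $\mathbf{T}(X,Y)=D_X\rho Y-D_Y\rho X-\rho[X,Y]$ and $\mathbf{K}(X,Y)\rho Z=-D_XD_Y\rho Z+D_YD_X\rho Z+D_{[X,Y]}\rho Z$. The h-curvature is $R(\overline{X},\overline{Y})\overline{Z}=\mathbf{K}(\beta\overline{X},\beta\overline{Y})\overline{Z}$, the (v)h-torsion is $\widehat{R}(\overline{X},\overline{Y})=R(\overline{X},\overline{Y})\overline{\eta}$,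 and the (v)hv-torsion is $\widehat{P}(\overline{X},\overline{Y})=\mathbf{K}(\beta\overline{X},\gamma\overline{Y})\overline{\eta}$. For a Finsler manifold $(M,L)$ with Finsler metric $g$ on $\pi^{-1}(TM)$ (locally $g_{ij}=\frac12\partial^2L^2/\partial y^i\partial y^j$), the Berwald connection $D^{\circ}$ is the unique regular connection on $\pi^{-1}(TM)$ that is torsion-free ($\mathbf{T}^{\circ}=0$), has vanishing (v)hv-torsion, and satisfies $D^{\circ}_{h^{\circ}X}L=0$, $h^{\circ}=\beta\circ\rho$ being its horizontal projector. $R^{\circ}$ and $\widehat{R^{\circ}}$ denote its h-curvature and (v)h-torsion, $R^{\circ}(\overline{X},\overline{Y},\overline{Z},\overline{W}):=g(R^{\circ}(\overline{X},\overline{Y})\overline{Z},\overline{W})$, and $H(\overline{X}):=\widehat{R^{\circ}}(\overline{\eta},\overline{X})$ is the deviation tensor. Notation: $\ell(\overline{X}):=L^{-1}g(\overline{\eta},\overline{X})$, $\phi(\overline{X}):=\overline{X}-L^{-1}\ell(\overline{X})\overline{\eta}$, $\hbar(\overline{X},\overline{Y}):=g(\overline{X},\overline{Y})-\ell(\overline{X})\ell(\overline{Y})$, $\mathfrak{A}_{\overline{X},\overline{Y}}\{\omega(\overline{X},\overline{Y})\}:=\omega(\overline{X},\overline{Y})-\omega(\overline{Y},\overline{X})$. The projection operator $\mathcal{P}$ on a $(0,p)$ $\pi$-tensor field $\omega$ is $(\mathcal{P}\cdot\omega)(\overline{X}_1,\dots,\overline{X}_p):=\omega(\phi(\overline{X}_1),\dots,\phi(\overline{X}_p))$.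 Definitions: a Finsler manifold of dimension $n\ge3$ is of scalar curvature $k$, where $k\in C^\infty(\mathcal{T}M)$ is positively homogeneous of degree zero in $y$, if $H(\overline{X})=kL^2\phi(\overline{X})$; it is of constant curvature $k$ if moreover $k$ is constant. A Finsler manifold of dimension $n\ge4$ is of $H_p$-scalar curvature $\varepsilon$, where $\varepsilon\in C^\infty(\mathcal{T}M)$ is positively homogeneous of degree zero in $y$, if $(\mathcal{P}\cdot R^{\circ})(\overline{X},\overline{Y},\overline{Z},\overline{W})=\varepsilon\,\mathfrak{A}_{\overline{X},\overline{Y}}\{\hbar(\overline{X},\overline{Z})\hbar(\overline{Y},\overline{W})\}$; it is of $H_p$-constant curvature $\varepsilon$ if moreover $\varepsilon$ is constant. *)

(* Defs.v *)
From HB Require Import structures.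
From mathcomp Require Import all_boot all_order all_algebra.
From mathcomp Require Import all_classical all_reals all_analysis.

Set Implicit Arguments.
Unset Strict Implicit.
Unset Printing Implicit Defensive.

Import Order.TTheory GRing.Theory Num.Theory.
Import numFieldNormedType.Exports.

Local Open Scope classical_set_scope.
Local Open Scope ring_scope.

(* For [U] open and [V] finite-dimensional, [cdiff k U f] says that [f] is of
   class C^k on [U]: continuity of all the directional derivatives
   [fun x => 'd f x v] is then the continuity of ['d f]. *)
Fixpoint cdiff (R : realType) (V W : normedModType R) (k : nat)
    (U : set V) (f : V -> W) : Prop :=
  match k with
  | 0 => forall x, U x -> {for x, continuous f}
  | k'.+1 => (forall x, U x -> differentiable f x) /\
             (forall v, cdiff k' U (fun x => 'd f x v))
  end.

Definition smooth_on (R : realType) (V W : normedModType R)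
    (U : set V) (f : V -> W) : Prop :=
  forall k, cdiff k U f.

(* Only the values of [chart i] on [chart_dom i], and of its inverse
   [chart_inv i] on the image of [chart_dom i], are meaningful. *)
Record smooth_manifold (R : realType) (n : nat) := SmoothManifold {
  carrier :> topologicalType;
  chart_index : Type;
  chart_dom : chart_index -> set carrier;
  chart : chart_index -> carrier -> 'rV[R]_n;
  chart_inv : chart_index -> 'rV[R]_n -> carrier;
  carrier_hausdorff : hausdorff_space carrier;
  carrier_second_countable : @second_countable carrier;
  chart_dom_open : forall i, open (chart_dom i);
  chart_cover : forall p, exists i, chart_dom i p;
  chart_img_open : forall i, open (chart i @` chart_dom i);
  chartK : forall i p, chart_dom i p -> chart_inv i (chart i p) = p;
  chart_continuous : forall i p, chart_dom i p -> {for p, continuous (chart i)};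
  chart_inv_continuous : forall i x, (chart i @` chart_dom i) x ->
    {for x, continuous (chart_inv i)};
  chart_transition_smooth : forall i j,
    smooth_on (chart i @` (chart_dom i `&` chart_dom j))
      (fun x => chart j (chart_inv i x))
}.

Section SlitTangentBundle.
Context {R : realType} {n : nat} (M : smooth_manifold R n).

Definition slit_coord : Type := ('rV[R]_n * 'rV[R]_n)%type.

Definition transition (i j : chart_index M) (x : 'rV[R]_n) : 'rV[R]_n :=
  chart j (chart_inv i x).

(* TM minus the zero section is the gluing of the open sets
   [slit_dom i] (natural coordinates (x, y), with y <> 0) along
   [slit_transition i j : slit_overlap i j -> slit_overlap j i].
   Accordingly, a function on it is a family of functions of (x, y), one for
   each chart, compatible with [slit_transition]; a vector field (resp. a
   pi-vector field) over the part of it above [chart_dom i] is a function on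
   [slit_dom i] with values in the tangent space [slit_coord] (resp. in ['rV_n]).
   Values outside [slit_dom i] are irrelevant. Connections being local
   operators, a tensorial identity holds for all global fields if and only if
   it holds for all smooth fields over each [slit_dom i]; identities are stated
   below in the latter form. *)
Definition slit_dom (i : chart_index M) : set slit_coord :=
  [set u | (chart i @` chart_dom i) u.1 /\ u.2 != 0].

Definition slit_overlap (i j : chart_index M) : set slit_coord :=
  [set u | (chart i @` (chart_dom i `&` chart_dom j)) u.1 /\ u.2 != 0].

Definition slit_transition (i j : chart_index M) (u : slit_coord) : slit_coord :=
  (transition i j u.1, 'd (transition i j) (u.1) (u.2)).

Definition slit_function : Type := chart_index M -> slit_coord -> R.

Definition smooth_function (f : slit_function) : Prop :=
  (forall i, smooth_on (slit_dom i) (f i : slit_coord -> R^o)) /\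
  (forall i j u, slit_overlap i j u -> f j (slit_transition i j u) = f i u).

Definition pos_homogeneous (d : nat) (f : slit_function) : Prop :=
  forall i u t, slit_dom i u -> 0 < t -> f i (u.1, t *: u.2) = t ^+ d * f i u.

Definition vector_field : Type := slit_coord -> slit_coord.
Definition pi_field : Type := slit_coord -> 'rV[R]_n.

Definition dir_deriv (X : vector_field) (f : slit_coord -> R) (u : slit_coord) : R :=
  'd (f : slit_coord -> R^o) u (X u).

Definition lie_bracket (X Y : vector_field) : vector_field :=
  fun u => 'd Y u (X u) - 'd X u (Y u).

(* The maps rho and gamma of the exact sequence
   0 -> pi^-1(TM) -> T(TM \ 0) -> pi^-1(TM) -> 0 in natural coordinates:
   rho is the differential of (x, y) |-> x, and gamma v at (x, y) is the
   velocity at t = 0 of t |-> (x, y + t v). *)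
Definition rho (w : slit_coord) : 'rV[R]_n := w.1.
Definition gam (v : 'rV[R]_n) : slit_coord := (0, v).

Definition eta : pi_field := fun u => u.2.

(* Koszul connections on pi^-1(TM): one covariant derivative over each
   [slit_dom i], compatible with changes of charts. For [i = j], [conn_natural]
   is the locality of the covariant derivative. *)
Record pi_connection := PiConnection {
  conn :> chart_index M -> vector_field -> pi_field -> pi_field;
  conn_smooth : forall i X Z,
    smooth_on (slit_dom i) X -> smooth_on (slit_dom i) Z ->
    smooth_on (slit_dom i) (conn i X Z);
  conn_addl : forall i X Y Z,
    smooth_on (slit_dom i) X -> smooth_on (slit_dom i) Y ->
    smooth_on (slit_dom i) Z ->
    forall u, slit_dom i u ->
      conn i (fun v => X v + Y v) Z u = conn i X Z u + conn i Y Z u;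
  conn_scalel : forall i (f : slit_coord -> R) X Z,
    smooth_on (slit_dom i) (f : slit_coord -> R^o) ->
    smooth_on (slit_dom i) X -> smooth_on (slit_dom i) Z ->
    forall u, slit_dom i u ->
      conn i (fun v => f v *: X v) Z u = f u *: conn i X Z u;
  conn_addr : forall i X Z W,
    smooth_on (slit_dom i) X -> smooth_on (slit_dom i) Z ->
    smooth_on (slit_dom i) W ->
    forall u, slit_dom i u ->
      conn i X (fun v => Z v + W v) u = conn i X Z u + conn i X W u;
  conn_leibniz : forall i (f : slit_coord -> R) X Z,
    smooth_on (slit_dom i) (f : slit_coord -> R^o) ->
    smooth_on (slit_dom i) X -> smooth_on (slit_dom i) Z ->
    forall u, slit_dom i u ->
      conn i X (fun v => f v *: Z v) u =
      dir_deriv X f u *: Z u + f u *: conn i X Z u;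
  conn_natural : forall i j X Z X' Z' u,
    smooth_on (slit_dom i) X -> smooth_on (slit_dom i) Z ->
    smooth_on (slit_dom j) X' -> smooth_on (slit_dom j) Z' ->
    slit_overlap i j u ->
    (\forall v \near u,
       X' (slit_transition i j v) = 'd (slit_transition i j) v (X v) /\
       Z' (slit_transition i j v) = 'd (transition i j) (v.1) (Z v)) ->
    conn j X' Z' (slit_transition i j u) =
    'd (transition i j) (u.1) (conn i X Z u)
}.

Section Connection.
Variable D : pi_connection.

(* [D_w eta] depends only on the vector [w] at [u], which is extended here by
   the field with constant components. *)
Definition horizontal (i : chart_index M) (u : slit_coord) : set slit_coord :=
  [set w | D i (fun=> w) eta u = 0].

Definition vertical : set slit_coord := range gam.

Definition regular : Prop :=
  forall i u, slit_dom i u ->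
    (forall w, exists v h, [/\ vertical v, horizontal i u h & w = v + h]) /\
    vertical `&` horizontal i u = [set 0].

(* The inverse of the restriction of rho to [horizontal i u] when [D] is
   regular. *)
Definition beta (i : chart_index M) (u : slit_coord) (v : 'rV[R]_n) : slit_coord :=
  xget 0 [set w | horizontal i u w /\ rho w = v].

Definition beta_field (i : chart_index M) (X : pi_field) : vector_field :=
  fun u => beta i u (X u).

Definition gam_field (X : pi_field) : vector_field := fun u => gam (X u).

Definition rho_field (X : vector_field) : pi_field := fun u => rho (X u).

Definition hproj (i : chart_index M) (X : vector_field) : vector_field :=
  beta_field i (rho_field X).

Definition torsion (i : chart_index M) (X Y : vector_field) : pi_field :=
  fun u => D i X (rho_field Y) u - D i Y (rho_field X) u
           - rho (lie_bracket X Y u).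

(* The opposite of the more common sign convention. *)
Definition curvature (i : chart_index M) (X Y : vector_field) (Z : pi_field) :
    pi_field :=
  fun u => - D i X (D i Y Z) u + D i Y (D i X Z) u
           + D i (lie_bracket X Y) Z u.

Definition hcurvature (i : chart_index M) (X Y Z : pi_field) : pi_field :=
  curvature i (beta_field i X) (beta_field i Y) Z.

Definition vh_torsion (i : chart_index M) (X Y : pi_field) : pi_field :=
  hcurvature i X Y eta.

Definition vhv_torsion (i : chart_index M) (X Y : pi_field) : pi_field :=
  curvature i (beta_field i X) (gam_field Y) eta.

Definition deviation (i : chart_index M) (X : pi_field) : pi_field :=
  vh_torsion i eta X.

End Connection.

(* (1/2) d^2 f^2 / dy^a dy^b contracted with [v] and [w]. *)
Definition fundamental_tensor (f : slit_function) (i : chart_index M)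
    (u : slit_coord) (v w : 'rV[R]_n) : R :=
  2^-1 * dir_deriv (fun=> gam v) (dir_deriv (fun=> gam w) (fun z => f i z ^+ 2)) u.

Record finsler_structure := FinslerStructure {
  finsler_fun :> chart_index M -> slit_coord -> R;
  finsler_smooth : smooth_function finsler_fun;
  finsler_pos : forall i u, slit_dom i u -> 0 < finsler_fun i u;
  finsler_homogeneous : pos_homogeneous 1 finsler_fun;
  finsler_definite : forall i u v, slit_dom i u -> v != 0 ->
    0 < fundamental_tensor finsler_fun i u v v
}.

Section Finsler.
Variables (L : finsler_structure) (D : pi_connection).

Definition gmetric (i : chart_index M) (u : slit_coord) (v w : 'rV[R]_n) : R :=
  fundamental_tensor L i u v w.

Definition is_berwald : Prop :=
  [/\ regular D,
      forall i X Y, smooth_on (slit_dom i) X -> smooth_on (slit_dom i) Y ->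
        forall u, slit_dom i u -> torsion D i X Y u = 0,
      forall i X Y, smooth_on (slit_dom i) X -> smooth_on (slit_dom i) Y ->
        forall u, slit_dom i u -> vhv_torsion D i X Y u = 0 &
      forall i X, smooth_on (slit_dom i) X ->
        forall u, slit_dom i u -> dir_deriv (hproj D i X) (L i) u = 0].

Definition ell (i : chart_index M) (u : slit_coord) (v : 'rV[R]_n) : R :=
  (L i u)^-1 * gmetric i u (eta u) v.

Definition phi (i : chart_index M) (u : slit_coord) (v : 'rV[R]_n) : 'rV[R]_n :=
  v - ((L i u)^-1 * ell i u v) *: eta u.

Definition angular (i : chart_index M) (u : slit_coord) (v w : 'rV[R]_n) : R :=
  gmetric i u v w - ell i u v * ell i u w.

Definition phi_field (i : chart_index M) (X : pi_field) : pi_field :=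
  fun u => phi i u (X u).

Definition hcurvature4 (i : chart_index M) (X Y Z W : pi_field) (u : slit_coord) :
    R :=
  gmetric i u (hcurvature D i X Y Z u) (W u).

Definition Pproj4 (i : chart_index M)
    (omega : pi_field -> pi_field -> pi_field -> pi_field -> slit_coord -> R)
    (X Y Z W : pi_field) (u : slit_coord) : R :=
  omega (phi_field i X) (phi_field i Y) (phi_field i Z) (phi_field i W) u.

Definition alternate (omega : pi_field -> pi_field -> slit_coord -> R)
    (X Y : pi_field) (u : slit_coord) : R :=
  omega X Y u - omega Y X u.

Definition scalar_curvature (k : slit_function) : Prop :=
  [/\ (3 <= n)%N, smooth_function k, pos_homogeneous 0 k &
      forall i X, smooth_on (slit_dom i) X ->
        forall u, slit_dom i u ->
          deviation D i X u = (k i u * L i u ^+ 2) *: phi i u (X u)].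

Definition constant_curvature (k : R) : Prop := scalar_curvature (fun _ _ => k).

Definition Hp_scalar_curvature (eps : slit_function) : Prop :=
  [/\ (4 <= n)%N, smooth_function eps, pos_homogeneous 0 eps &
      forall i X Y Z W,
        smooth_on (slit_dom i) X -> smooth_on (slit_dom i) Y ->
        smooth_on (slit_dom i) Z -> smooth_on (slit_dom i) W ->
        forall u, slit_dom i u ->
          Pproj4 i (hcurvature4 i) X Y Z W u =
          eps i u *
          alternate (fun X' Y' v =>
            angular i v (X' v) (Z v) * angular i v (Y' v) (W v)) X Y u].

Definition Hp_constant_curvature (eps : R) : Prop :=
  Hp_scalar_curvature (fun _ _ => eps).

End Finsler.
End SlitTangentBundle.

(* Main.v *)
From HB Require Import structures.
Require Import Defs.
From mathcomp Require Import all_boot all_order all_algebra.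
From mathcomp Require Import all_classical all_reals all_analysis.
From mathcomp Require Import ring.

(** Constant curvature prescribes the deviation tensor H, which is the
h-curvature contracted twice with the fundamental field eta. The Berwald
connection is special in that this contraction loses nothing: the whole
h-curvature is recovered from H by two differentiations along the fibres.

In a chart, the absence of torsion means that D_X Z = dZ(X) + Gam(rho X, Z)
with Gam symmetric ([conn_christoffel], [christoffel_sym]); hence the
horizontal lift of v at (x, y) is (v, - N_v) with N_v = Gam(v, y) ([betaE]).
The vanishing of the (v)hv-torsion says that the derivative of N_v along the
vertical vector b is Gam(v, b) ([d_nonlinear_vert]). Writing R(x, y)z for the
h-curvature, which is a function of the values of the fields at the point
([curvatureE], [hcurvatureE]), three facts follow.
- R(x, y)eta = dN_x(y^h) - dN_y(x^h), the superscript standing for the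
  horizontal lift, and by symmetry of second derivatives the derivative of
  R(x, y)eta along the vertical vector z is R(x, y)z ([d_rcurv_eta]).
- The first Bianchi identity holds ([bianchi]).
- Consequently, with H_x = R(eta, x)eta, the vertical derivatives satisfy
  d_z H_x - d_x H_z = 3 R(z, x)eta ([rcurv_eta_deviation]).

Now let H_x = k L^2 phi(x). By Euler's identity g(eta, x) is half of the
vertical derivative d_x L^2, so that H_x = k (L^2 x - (1/2) (d_x L^2) eta).
Feeding this into the last identity gives
R(z, x)eta = (k/2) ((d_z L^2) x - (d_x L^2) z), and one more vertical
derivative gives R(z, x)w = k (g(w, z) x - g(w, x) z) ([rcurv_gmetric]); here
the constancy of k is essential. The theorem follows by evaluating this formula
on vectors of the form phi(x), since g(phi x, phi y) is the angular metric
([gmetric_phi]).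

The analytic input is the closure of smooth functions under the operations
involved, the Leibniz rule for F_x(Y x) with F_x linear ([is_diff_contract]),
and the symmetry of second derivatives ([schwarz]). *)

Set Implicit Arguments.
Unset Strict Implicit.
Unset Printing Implicit Defensive.

Import Order.TTheory GRing.Theory Num.Theory.
Import numFieldNormedType.Exports.

Local Open Scope classical_set_scope.
Local Open Scope ring_scope.

(** * Rules of differentiation *)

Section LinearMaps.
Context {R : realType}.

Definition row_coord m (j : 'I_m) (x : 'rV[R]_m) : R^o := x 0 j.

Lemma row_coord_linear m (j : 'I_m) : linear (row_coord j).
Proof. by move=> a u v; rewrite /row_coord !mxE. Qed.

HB.instance Definition _ m (j : 'I_m) :=
  GRing.isLinear.Build R 'rV[R]_m R^o _ (row_coord j) (row_coord_linear j).

Lemma linear_row (W : lmodType R) m (g : 'rV[R]_m -> W) e : linear g ->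
  g e = \sum_j e 0 j *: g (delta_mx 0 j).
Proof.
move=> gl.
pose G : {linear 'rV[R]_m -> W} := HB.pack g (GRing.isLinear.Build _ _ _ _ _ gl).
rewrite {1}[e]row_sum_delta -[g]/(G : _ -> _) linear_sum.
by apply: eq_bigr => j _; rewrite linearZ.
Qed.

Lemma linear_pair (W V1 V2 : lmodType R) (g : V1 * V2 -> W) a b : linear g ->
  g (a, b) = g (a, 0) + g (0, b).
Proof.
move=> gl; have := gl 1 (a, 0) (0, b); rewrite !scale1r => <-.
by congr g; rewrite /GRing.add /= /add_pair /= addr0 add0r.
Qed.

Lemma linear_pairl (W V1 V2 : lmodType R) (g : V1 * V2 -> W) : linear g ->
  linear (fun a => g (a, 0)).
Proof.
move=> gl c a b; rewrite -gl; congr g.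
by rewrite /GRing.add /GRing.scale/= /add_pair /scale_pair/= scaler0 addr0.
Qed.

Lemma linear_pairr (W V1 V2 : lmodType R) (g : V1 * V2 -> W) : linear g ->
  linear (fun b => g (0, b)).
Proof.
move=> gl c a b; rewrite -gl; congr g.
by rewrite /GRing.add /GRing.scale/= /add_pair /scale_pair/= scaler0 addr0.
Qed.

End LinearMaps.

Section Differentiation.
Context {R : realType}.

Lemma is_diffE (V W : normedModType R) (f df : V -> W) x w :
  is_diff x f df -> 'd f x w = df w.
Proof. by move=> dfx; rewrite diff_val. Qed.

Lemma d_cst (V W : normedModType R) (a : W) (x w : V) : 'd (fun=> a) x w = 0.
Proof. exact: (is_diffE w (is_diff_cst a x)). Qed.

Lemma is_diff_near_eq (V W : normedModType R) (f g df : V -> W) (x : V) :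
  (\forall y \near x, f y = g y) -> is_diff x f df -> is_diff x g df.
Proof.
move=> fg dfx; have fgx : f x = g x by exact: nbhs_singleton fg.
have cf : continuous ('d f x) by apply: diff_continuous.
have E : g \o shift x = cst (g x) + 'd f x +o_ 0 id.
  have := diff_locally (@ex_diff _ _ _ _ _ _ _ dfx) => /eqaddoP lf.
  apply/eqaddoP => e e0; have := lf e e0; apply: filter_app.
  have : \forall y \near 0, f (y + x) = g (y + x).
    have := fg; rewrite (near_shift 0)/=; apply: filter_app.
    by near=> y; rewrite subr0.
  apply: filter_app; near=> y => /= fgy.
  by rewrite !fctE /= fgx fgy.
have dgE : 'd g x = 'd f x :> (V -> W) by exact: diff_unique.
apply: DiffDef; last by rewrite dgE diff_val.
by apply/diff_locallyP; rewrite dgE.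
Unshelve. all: by end_near. Qed.

Lemma is_diff_scale (V W : normedModType R) (k dk : V -> R^o) (f df : V -> W) x :
  is_diff x k dk -> is_diff x f df ->
  is_diff x (fun y => k y *: f y) (fun w => k x *: df w + dk w *: f x).
Proof.
move=> dkx dfx.
have bil : bilinear_for (GRing.Scale.Law.clone _ _ *:%R _)
   (GRing.Scale.Law.clone _ _ *:%R _) (fun (a : R^o) (w : W) => a *: w).
  split=> [w|a] b y z /=; first by rewrite scalerDl scalerA.
  by rewrite scalerDr !scalerA mulrC.
pose B := bilinear_isBilinear.Build R R^o W W _ _ _ bil.
pose b : {bilinear R^o -> W -> W} := HB.pack (fun (a : R^o) (w : W) => a *: w) B.
have cb : continuous (fun p : R^o * W => b p.1 p.2).
  by move=> p; exact: (@scale_continuous R W p).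
have db : is_diff (k x, f x) (fun p : R^o * W => b p.1 p.2)
   (fun q => b (k x) q.2 + b q.1 (f x)).
  by apply: DiffDef; [exact: differentiable_bilin|rewrite diff_bilin].
have dp : is_diff x (fun y => (k y, f y)) (fun y => (dk y, df y)).
  exact: is_diff_pair.
exact: (is_diff_comp dp db).
Qed.

Lemma is_diff_sum (V W : normedModType R) m (f df : 'I_m -> V -> W) x :
  (forall j, is_diff x (f j) (df j)) ->
  is_diff x (fun y => \sum_j f j y) (fun y => \sum_j df j y).
Proof.
move=> fd.
have -> : (fun y => \sum_j f j y) = \sum_j f j.
  by apply/funext => y; rewrite fct_sumE.
have -> : (fun y => \sum_j df j y) = \sum_j df j.
  by apply/funext => y; rewrite fct_sumE.
by elim/big_ind2 : _ => // *; [exact: is_diff_cst|exact: is_diffD].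
Qed.

Lemma is_diff_linear (V W Z : normedModType R) (h : {linear W -> Z})
    (f df : V -> W) x :
  continuous h -> is_diff x f df -> is_diff x (h \o f) (h \o df).
Proof.
move=> hc fd; have hd : is_diff (f x) h h.
  by apply: DiffDef; [exact: linear_differentiable|rewrite diff_lin].
exact: is_diff_comp.
Qed.

Lemma is_diff_coord (V : normedModType R) m (f df : V -> 'rV[R]_m) x j :
  is_diff x f df -> is_diff x (fun y => f y 0 j : R^o) (fun w => df w 0 j).
Proof. by apply: (is_diff_linear (h := row_coord j)); exact: coord_continuous. Qed.

Lemma is_diff_fst (V W1 W2 : normedModType R) (f df : V -> W1 * W2) x :
  is_diff x f df -> is_diff x (fun y => (f y).1) (fun y => (df y).1).
Proof. by apply: (is_diff_linear (h := @fst W1 W2)) => y; exact: cvg_fst. Qed.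

Lemma is_diff_snd (V W1 W2 : normedModType R) (f df : V -> W1 * W2) x :
  is_diff x f df -> is_diff x (fun y => (f y).2) (fun y => (df y).2).
Proof. by apply: (is_diff_linear (h := @snd W1 W2)) => y; exact: cvg_snd. Qed.

(** Leibniz rule for a family of linear maps applied to a varying vector. Only
the differentiability of [F ^~ e] for each fixed [e] is assumed: expanding
[Y y] in the canonical basis reduces the rule to finitely many scalings. *)
Lemma is_diff_contract (V W : normedModType R) m (F : V -> 'rV[R]_m -> W)
    (dF : 'rV[R]_m -> V -> W) (Y dY : V -> 'rV[R]_m) x :
  (\forall y \near x, linear (F y)) ->
  (forall e, is_diff x (F ^~ e) (dF e)) -> is_diff x Y dY ->
  is_diff x (fun y => F y (Y y)) (fun w => dF (Y x) w + F x (dY w)).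
Proof.
move=> Fl Fd Yd.
have Fx : linear (F x) by exact: nbhs_singleton Fl.
have Gd (Z dZ : V -> 'rV[R]_m) : is_diff x Z dZ ->
  is_diff x (fun y => F y (Z y)) (fun w => \sum_j
    (Z x 0 j *: dF (delta_mx 0 j) w + dZ w 0 j *: F x (delta_mx 0 j))).
  move=> Zd.
  apply: (@is_diff_near_eq _ _
    (fun y => \sum_j (Z y 0 j : R^o) *: F y (delta_mx 0 j))).
    by apply: filterS Fl => y Fy; rewrite (linear_row _ Fy).
  apply: is_diff_sum => j.
  exact: (is_diff_scale (is_diff_coord j Zd) (Fd (delta_mx 0 j))).
apply: is_diff_eq (Gd _ _ Yd) _; apply/funext => w.
rewrite big_split/= -(linear_row _ Fx); congr +%R.
(* The same expansion for the constant field [Y x] identifies [dF (Y x)]. *)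
have := Gd (cst (Y x)) 0 (is_diff_cst _ _) => /(is_diffE w).
have /(is_diffE w) -> : is_diff x (fun y => F y (cst (Y x) y)) (dF (Y x)).
  exact: Fd.
by move=> ->; apply: eq_bigr => j _; rewrite !fctE mxE scale0r addr0.
Qed.

Lemma is_diff_contract_pair (V W : normedModType R) m p
    (F : V -> ('rV[R]_m * 'rV[R]_p)%type -> W)
    (dF : 'rV[R]_m * 'rV[R]_p -> V -> W)
    (Y dY : V -> ('rV[R]_m * 'rV[R]_p)%type) x :
  (\forall y \near x, linear (F y)) ->
  (forall e, is_diff x (F ^~ e) (dF e)) -> is_diff x Y dY ->
  is_diff x (fun y => F y (Y y)) (fun w => dF (Y x) w + F x (dY w)).
Proof.
move=> Fl Fd Yd.
have Fx : linear (F x) by exact: nbhs_singleton Fl.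
have Fl1 : \forall y \near x, linear (fun a => F y (a, 0)).
  by apply: filterS Fl => y; exact: linear_pairl.
have Fl2 : \forall y \near x, linear (fun a => F y (0, a)).
  by apply: filterS Fl => y; exact: linear_pairr.
have H1 := is_diff_contract Fl1 (fun e => Fd (e, 0)) (is_diff_fst Yd).
have H2 := is_diff_contract Fl2 (fun e => Fd (0, e)) (is_diff_snd Yd).
apply: is_diff_eq (@is_diff_near_eq _ _
  (fun y => F y ((Y y).1, 0) + F y (0, (Y y).2)) _ _ _ _ (is_diffD H1 H2)) _.
  apply: filterS Fl => y Fy.
  by rewrite -(linear_pair _ _ Fy) -surjective_pairing.
apply/funext => w.
rewrite fctE addrACA -(linear_pair _ _ Fx) -surjective_pairing; congr +%R.
have Fe : is_diff x (fun y => F y ((Y x).1, 0) + F y (0, (Y x).2))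
    (dF ((Y x).1, 0) + dF (0, (Y x).2)).
  exact: (is_diffD (Fd _) (Fd _)).
have Fe' : is_diff x (F ^~ (Y x)) (dF ((Y x).1, 0) + dF (0, (Y x).2)).
  apply: is_diff_near_eq Fe; apply: filterS Fl => y Fy.
  by rewrite -(linear_pair _ _ Fy) -surjective_pairing.
by rewrite -(is_diffE w (Fd (Y x))) (is_diffE w Fe').
Qed.

End Differentiation.

(** * Symmetry of second derivatives *)

Section Schwarz.
Context {R : realType}.

Lemma is_derive_line (V : normedModType R) (f : V -> R^o) a v (s : R) :
  differentiable f (a + s *: v) ->
  is_derive s (1 : R) (fun t : R => f (a + t *: v) : R) ('d f (a + s *: v) v).
Proof.
move=> fd.
have ld : is_diff s (fun t : R => a + t *: v) (fun t => t *: v).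
  have H : is_diff s (fun t : R => a + t *: v) (0 + *:%R^~ v).
    exact: (is_diffD (is_diff_cst a s) (is_diff_scalel s v)).
  by apply: is_diff_eq H _; rewrite add0r.
have cd := is_diff_comp ld (differentiableP fd).
have cdf : differentiable (f \o (fun t : R => a + t *: v)) s by case: cd.
apply: DeriveDef; first exact: diff_derivable cdf.
by rewrite (deriveE _ cdf) (is_diffE _ cd) /= scale1r.
Qed.

(** The mean value theorem, used first in the direction [v] for the increment
of [f] along [h *: w] and then in the direction [w], turns the second difference
into a second derivative at some point of the parallelogram. *)
Lemma second_difference (V : normedModType R) (f : V -> R^o) u v w (h : R) :
  0 < h ->
  (forall s t, 0 <= s <= h -> 0 <= t <= h ->
     differentiable f (u + s *: v + t *: w) /\
     differentiable (fun x => 'd f x v) (u + s *: v + t *: w)) ->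
  exists s t, [/\ 0 <= s <= h, 0 <= t <= h &
    f (u + h *: v + h *: w) - f (u + h *: v) - f (u + h *: w) + f u =
    'd (fun x => 'd f x v : R^o) (u + s *: v + t *: w) w * h * h].
Proof.
move=> h0 fd.
have h00 : 0 <= (0 : R) <= h by rewrite lexx ltW.
have hhh : 0 <= h <= h by rewrite lexx ltW.
pose g (s : R) : R := f (u + h *: w + s *: v) - f (u + s *: v).
pose dg (s : R) : R := 'd f (u + h *: w + s *: v) v - 'd f (u + s *: v) v.
have gd (s : R) : 0 <= s <= h -> is_derive s 1 g (dg s).
  move=> sh; have [f1 _] := fd s h sh hhh; have [f2 _] := fd s 0 sh h00.
  apply: is_deriveB; apply: is_derive_line; first by rewrite addrAC.
  by rewrite -[_ + _]addr0 -[X in _ + X](scale0r w).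
have [|s|s s0h gE] := @MVT R g dg 0 h h0.
- by move=> s; rewrite in_itv/= => /andP[s0 sh]; apply: gd; rewrite !ltW.
- move: s; apply: derivable_within_continuous => s.
  by rewrite in_itv/= => sh; case: (gd s sh).
have {}s0h : 0 <= s <= h.
  by move: s0h; rewrite in_itv/= => /andP[? ?]; rewrite !ltW.
pose k (t : R) : R := 'd f (u + s *: v + t *: w) v.
pose dk (t : R) : R := 'd (fun x => 'd f x v : R^o) (u + s *: v + t *: w) w.
have kd (t : R) : 0 <= t <= h -> is_derive t 1 k (dk t).
  by move=> th; have [_ f2] := fd s t s0h th; exact: (is_derive_line f2).
have [|t|t t0h kE] := @MVT R k dk 0 h h0.
- by move=> t; rewrite in_itv/= => /andP[t0 th]; apply: kd; rewrite !ltW.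
- move: t; apply: derivable_within_continuous => t.
  by rewrite in_itv/= => th; case: (kd t th).
exists s, t; split=> //.
  by move: t0h; rewrite in_itv/= => /andP[? ?]; rewrite !ltW.
move: gE kE; rewrite /g /dg /k /dk !scale0r !addr0 !subr0 => gE kE.
rewrite -kE [in RHS](addrAC u) -gE (addrAC u (h *: v)) opprB !addrA.
by rewrite [RHS]addrAC; congr (_ + _); rewrite addrAC.
Qed.

(** The second difference along [h *: v] and [h *: w] is symmetric in [v] and
[w]. It is [h * h] times a value near [u] of either mixed derivative, and both
are continuous at [u]. *)
Lemma schwarz (V : normedModType R) (U : set V) (f : V -> R^o) u v w :
  open U -> U u -> cdiff 2 U f ->
  'd (fun x => 'd f x v : R^o) u w = 'd (fun x => 'd f x w : R^o) u v.
Proof.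
move=> Uo Uu [fd f2].
pose a x := 'd (fun x => 'd f x v : R^o) x w : R.
pose b x := 'd (fun x => 'd f x w : R^o) x v : R.
rewrite -/(a u) -/(b u); apply/eqP; rewrite -subr_eq0 -normr_le0.
apply/ler_addgt0Pl => e e0; rewrite addr0.
have e20 : 0 < e / 2 by rewrite divr_gt0.
have ca : {for u, continuous (a : V -> R^o)}.
  by have [_ /(_ w u Uu)] := f2 v.
have cb : {for u, continuous (b : V -> R^o)}.
  by have [_ /(_ v u Uu)] := f2 w.
have : \forall x \near u, [/\ U x, `|a u - a x| < e / 2 & `|b u - b x| < e / 2].
  have Ux : \forall x \near u, U x by exact: open_nbhs_nbhs.
  have /cvgrPdist_lt/(_ _ e20) Ax := ca; have /cvgrPdist_lt/(_ _ e20) Bx := cb.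
  by near=> x; split; near: x.
move=> /nbhs_normP[d /= d0 dP].
(* The parallelogram of size [h] lies in the ball of radius [d / 2]. *)
pose N := `|v| + `|w| + 1.
have N0 : 0 < N by rewrite ltr_wpDl// addr_ge0.
pose h := d / (2 * N).
have h0 : 0 < h by rewrite divr_gt0// mulr_gt0.
have near_u s t (v' w' : V) : `|v'| + `|w'| = `|v| + `|w| ->
    0 <= s <= h -> 0 <= t <= h ->
    [/\ U (u + s *: v' + t *: w'), `|a u - a (u + s *: v' + t *: w')| < e / 2
      & `|b u - b (u + s *: v' + t *: w')| < e / 2].
  move=> vw /andP[s0 sh] /andP[t0 th]; apply: dP => /=.
  rewrite !opprD !addrA subrr sub0r -opprD normrN (le_lt_trans (ler_normD _ _))//.
  rewrite !normrZ !ger0_norm//.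
  apply: (@le_lt_trans _ _ (h * N)).
    rewrite /N -vw -addrA mulrDr lerD ?ler_wpM2r//.
    by rewrite mulrDr mulr1 (le_trans (ler_wpM2r _ th))// lerDl ltW.
  by rewrite /h invfM mulrA mulfVK ?gt_eqF// ltr_pdivrMr// mulr_natr mulr2n ltrDl.
have [|s [t [sh th E1]]] := @second_difference V f u v w h h0.
  move=> s t sh th; have [Ux _ _] := near_u s t v w erefl sh th.
  by split; [exact: fd | have [d2 _] := f2 v; exact: d2].
have wv : `|w| + `|v| = `|v| + `|w| by rewrite addrC.
have [|s' [t' [sh' th' E2]]] := @second_difference V f u w v h h0.
  move=> s' t' sh' th'; have [Ux _ _] := near_u s' t' w v wv sh' th'.
  by split; [exact: fd | have [d2 _] := f2 w; exact: d2].
have [_ As _] := near_u s t v w erefl sh th.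
have [_ _ Bs] := near_u s' t' w v wv sh' th'.
have AB : a (u + s *: v + t *: w) = b (u + s' *: w + t' *: v).
  have hh : h != 0 by rewrite gt_eqF.
  apply: (mulIf hh); apply: (mulIf hh); rewrite -[LHS]E1 -[RHS]E2.
  by rewrite (addrAC u (h *: w)); congr (_ + _); exact: addrAC.
have -> : a u - b u = (a u - a (u + s *: v + t *: w))
    - (b u - b (u + s' *: w + t' *: v)).
  by rewrite AB opprB addrA subrK.
rewrite ltW// (le_lt_trans (ler_normB _ _))//.
by rewrite [ltRHS]splitr; apply: ltrD.
Unshelve. all: by end_near. Qed.

End Schwarz.

(** * Closure properties of smooth functions *)

Section Smooth.
Context {R : realType} {V : normedModType R} (U : set V) (Uo : open U).

Lemma near_open x : U x -> \forall y \near x, U y.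
Proof. by move=> Ux; exact: open_nbhs_nbhs. Qed.

Lemma cdiff_eq (W : normedModType R) k (f g : V -> W) :
  (forall x, U x -> f x = g x) -> cdiff k U f -> cdiff k U g.
Proof.
elim: k f g => [|k IH] f g fg /= => [fc x Ux|[fd fc]].
  rewrite /prop_for /continuous_at -(fg x Ux); apply: cvg_trans (fc x Ux).
  apply: near_eq_cvg; apply: filterS (near_open Ux) => y; exact: fg.
have fgd x (Ux : U x) : is_diff x g ('d f x).
  apply: is_diff_near_eq (differentiableP (fd x Ux)).
  by apply: filterS (near_open Ux) => y; exact: fg.
split=> [x Ux|v]; first by case: (fgd x Ux).
apply: IH (fc v) => x Ux; by rewrite (is_diffE v (fgd x Ux)).
Qed.

Lemma cdiffW (W : normedModType R) k (f : V -> W) :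
  cdiff k.+1 U f -> cdiff k U f.
Proof.
elim: k f => [|k IH] f [fd fc].
  by move=> x Ux; apply: differentiable_continuous; exact: fd.
by split=> // v; apply: IH; exact: fc.
Qed.

(** Since 'd is only controlled on [U], the closure properties below exhibit a
derivative valid on [U] and apply this criterion inductively. *)
Lemma cdiffS (W : normedModType R) k (f : V -> W) (df : V -> V -> W) :
  (forall x, U x -> is_diff x f (df x)) -> (forall v, cdiff k U (df ^~ v)) ->
  cdiff k.+1 U f.
Proof.
move=> fd fc; split=> [x Ux|v]; first by case: (fd x Ux).
by apply: cdiff_eq (fc v) => x Ux; rewrite (is_diffE v (fd x Ux)).
Qed.

Lemma cdiff_is_diff (W : normedModType R) k (f : V -> W) x :
  cdiff k.+1 U f -> U x -> is_diff x f ('d f x).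
Proof. by move=> [fd _] Ux; apply: differentiableP; exact: fd. Qed.

Lemma cdiff_d (W : normedModType R) k (f : V -> W) v :
  cdiff k.+1 U f -> cdiff k U (fun x => 'd f x v).
Proof. by move=> [_]; apply. Qed.

Lemma cdiff_cst (W : normedModType R) k (a : W) : cdiff k U (fun=> a).
Proof.
elim: k a => [|k IH] a; first by move=> x _; exact: cst_continuous.
by apply: (@cdiffS _ _ _ (fun _ _ => 0)) => v; exact: IH.
Qed.

Lemma cdiffD (W : normedModType R) k (f g : V -> W) :
  cdiff k U f -> cdiff k U g -> cdiff k U (fun x => f x + g x).
Proof.
elim: k f g => [|k IH] f g fk gk.
  by move=> x Ux; apply: continuousD; [exact: fk|exact: gk].
apply: (@cdiffS _ _ _ (fun x v => 'd f x v + 'd g x v)) => [x Ux|v].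
  exact: (is_diffD (cdiff_is_diff fk Ux) (cdiff_is_diff gk Ux)).
by apply: IH; exact: cdiff_d.
Qed.

Lemma cdiff_scale (W : normedModType R) k (c : V -> R^o) (f : V -> W) :
  cdiff k U c -> cdiff k U f -> cdiff k U (fun x => c x *: f x).
Proof.
elim: k c f => [|k IH] c f ck fk.
  by move=> x Ux; apply: continuousZ; [exact: ck|exact: fk].
apply: (@cdiffS _ _ _ (fun x v => c x *: 'd f x v + 'd c x v *: f x)) => [x Ux|v].
  exact: (is_diff_scale (cdiff_is_diff ck Ux) (cdiff_is_diff fk Ux)).
apply: cdiffD; first exact: IH (cdiffW ck) (cdiff_d v fk).
exact: IH (cdiff_d v ck) (cdiffW fk).
Qed.

Lemma cdiff_comp_linear (W Z : normedModType R) k (h : {linear W -> Z}) (f : V -> W) :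
  continuous h -> cdiff k U f -> cdiff k U (fun x => h (f x)).
Proof.
move=> hc; elim: k f => [|k IH] f fk.
  by move=> x Ux; apply: (@continuous_comp _ _ _ f h); [exact: fk|exact: hc].
apply: (@cdiffS _ _ _ (fun x v => h ('d f x v))) => [x Ux|v].
  exact: (is_diff_linear hc (cdiff_is_diff fk Ux)).
by apply: IH; exact: cdiff_d.
Qed.

Lemma cdiff_inv k (c : V -> R^o) : (forall x, U x -> c x != 0) ->
  cdiff k U c -> cdiff k U (fun x => (c x)^-1 : R^o).
Proof.
move=> c0; elim: k c c0 => [|k IH] c c0 ck.
  by move=> x Ux; apply: (@continuousV _ _ c); [exact: c0|exact: ck].
pose dc x v := (- (c x)^-1 * (c x)^-1) *: 'd c x v : R^o.
apply: (@cdiffS _ _ _ dc) => [x Ux|v].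
  apply: DiffDef.
    by apply: differentiableV; [case: ck => + _; exact|exact: c0].
  rewrite diffV; [|by case: ck => + _; exact|exact: c0].
  by apply/funext => v /=; rewrite /dc expr2 mulNr invfM.
have ci := IH c c0 (cdiffW ck).
apply: (@cdiff_scale _ _ (fun x => - (c x)^-1 * (c x)^-1)); last exact: cdiff_d.
apply: (@cdiff_scale _ _ (fun x => - (c x)^-1) (fun x => (c x)^-1)) => //.
apply: (@cdiff_eq _ _ (fun x => (-1) *: ((c x)^-1 : R^o))) => [x _|].
  by rewrite scaleN1r.
by apply: cdiff_scale => //; exact: cdiff_cst.
Qed.

Lemma cdiff_pair (W1 W2 : normedModType R) k (f : V -> W1) (g : V -> W2) :
  cdiff k U f -> cdiff k U g -> cdiff k U (fun x => (f x, g x)).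
Proof.
elim: k f g => [|k IH] f g fk gk.
  by move=> x Ux; apply: cvg_pair; [exact: fk|exact: gk].
apply: (@cdiffS _ _ _ (fun x v => ('d f x v, 'd g x v))) => [x Ux|v].
  exact: (is_diff_pair (cdiff_is_diff fk Ux) (cdiff_is_diff gk Ux)).
by apply: IH; exact: cdiff_d.
Qed.

Lemma smooth_eq (W : normedModType R) (f g : V -> W) :
  (forall x, U x -> f x = g x) -> smooth_on U f -> smooth_on U g.
Proof. by move=> fg fs k; apply: cdiff_eq (fs k). Qed.

Lemma smooth_is_diff (W : normedModType R) (f : V -> W) x :
  smooth_on U f -> U x -> is_diff x f ('d f x).
Proof. by move=> fs; exact: (@cdiff_is_diff _ 0 _ _ (fs 1%N)). Qed.

Lemma smooth_d (W : normedModType R) (f : V -> W) v :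
  smooth_on U f -> smooth_on U (fun x => 'd f x v).
Proof. by move=> fs k; exact: cdiff_d. Qed.

Lemma smooth_cst (W : normedModType R) (a : W) : smooth_on U (fun=> a).
Proof. by move=> k; exact: cdiff_cst. Qed.

Lemma smooth_id : smooth_on U id.
Proof.
case=> [|k]; first by move=> x _; exact: cvg_id.
by apply: (@cdiffS _ _ _ (fun _ v => v)) => v; exact: cdiff_cst.
Qed.

Lemma smoothD (W : normedModType R) (f g : V -> W) :
  smooth_on U f -> smooth_on U g -> smooth_on U (fun x => f x + g x).
Proof. by move=> fs gs k; exact: cdiffD. Qed.

Lemma smooth_scale (W : normedModType R) (c : V -> R^o) (f : V -> W) :
  smooth_on U c -> smooth_on U f -> smooth_on U (fun x => c x *: f x).
Proof. by move=> fs gs k; exact: cdiff_scale. Qed.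

Lemma smoothN (W : normedModType R) (f : V -> W) :
  smooth_on U f -> smooth_on U (fun x => - f x).
Proof.
move=> fs; apply: (@smooth_eq _ (fun x => (-1) *: f x)) => [x _|].
  by rewrite scaleN1r.
by apply: smooth_scale => //; exact: smooth_cst.
Qed.

Lemma smooth_comp_linear (W Z : normedModType R) (h : {linear W -> Z}) (f : V -> W) :
  continuous h -> smooth_on U f -> smooth_on U (fun x => h (f x)).
Proof. by move=> hc fs k; exact: cdiff_comp_linear. Qed.

Lemma smooth_inv (c : V -> R^o) : (forall x, U x -> c x != 0) ->
  smooth_on U c -> smooth_on U (fun x => (c x)^-1 : R^o).
Proof. by move=> c0 cs k; exact: cdiff_inv. Qed.

Lemma smooth_pair (W1 W2 : normedModType R) (f : V -> W1) (g : V -> W2) :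
  smooth_on U f -> smooth_on U g -> smooth_on U (fun x => (f x, g x)).
Proof. by move=> fs gs k; exact: cdiff_pair. Qed.

Lemma smooth_sum (W : normedModType R) m (f : 'I_m -> V -> W) (s : seq 'I_m) :
  (forall j, smooth_on U (f j)) -> smooth_on U (fun x => \sum_(j <- s) f j x).
Proof.
move=> fs; elim: s => [|j s IH].
  by apply: (@smooth_eq _ (fun=> 0)) => [x _|]; [rewrite big_nil|exact: smooth_cst].
apply: (@smooth_eq _ (fun x => f j x + \sum_(j <- s) f j x)) => [x _|].
  by rewrite big_cons.
exact: smoothD.
Qed.

Lemma smooth_coord m (f : V -> 'rV[R]_m) j :
  smooth_on U f -> smooth_on U (fun x => f x 0 j : R^o).
Proof. by apply: (smooth_comp_linear (h := row_coord j)); exact: coord_continuous. Qed.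

Lemma smooth_fst (W1 W2 : normedModType R) (f : V -> (W1 * W2)%type) :
  smooth_on U f -> smooth_on U (fun x => (f x).1).
Proof. by apply: (smooth_comp_linear (h := @fst W1 W2)) => y; exact: cvg_fst. Qed.

Lemma smooth_snd (W1 W2 : normedModType R) (f : V -> (W1 * W2)%type) :
  smooth_on U f -> smooth_on U (fun x => (f x).2).
Proof. by apply: (smooth_comp_linear (h := @snd W1 W2)) => y; exact: cvg_snd. Qed.

Lemma smooth_contract (W : normedModType R) m (F : V -> 'rV[R]_m -> W)
    (Y : V -> 'rV[R]_m) :
  (forall x, U x -> linear (F x)) -> (forall e, smooth_on U (F ^~ e)) ->
  smooth_on U Y -> smooth_on U (fun x => F x (Y x)).
Proof.
move=> Fl Fs Ys.
pose G y := \sum_j (Y y 0 j : R^o) *: F y (delta_mx 0 j).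
apply: (@smooth_eq _ G) => [x Ux|]; first by rewrite /G -(linear_row _ (Fl x Ux)).
apply: smooth_sum => j; apply: smooth_scale => //; exact: smooth_coord.
Qed.

Lemma smooth_contract_pair (W : normedModType R) m p
    (F : V -> ('rV[R]_m * 'rV[R]_p)%type -> W) (Y : V -> ('rV[R]_m * 'rV[R]_p)%type) :
  (forall x, U x -> linear (F x)) -> (forall e, smooth_on U (F ^~ e)) ->
  smooth_on U Y -> smooth_on U (fun x => F x (Y x)).
Proof.
move=> Fl Fs Ys.
pose G y := F y ((Y y).1, 0) + F y (0, (Y y).2).
apply: (@smooth_eq _ G) => [x Ux|].
  by rewrite /G -(linear_pair _ _ (Fl x Ux)) -surjective_pairing.
apply: smoothD.
  apply: (@smooth_contract _ _ (fun y a => F y (a, 0))) => //.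
    by move=> x Ux; exact: linear_pairl (Fl x Ux).
  exact: smooth_fst.
apply: (@smooth_contract _ _ (fun y a => F y (0, a))) => //.
  by move=> x Ux; exact: linear_pairr (Fl x Ux).
exact: smooth_snd.
Qed.

Lemma d_coord m (f : V -> 'rV[R]_m) x v j : differentiable f x ->
  'd (fun y => f y 0 j : R^o) x v = 'd f x v 0 j.
Proof. by move=> fd; rewrite (is_diffE v (is_diff_coord j (differentiableP fd))). Qed.

Lemma schwarz_row m (f : V -> 'rV[R]_m) u v w : smooth_on U f -> U u ->
  'd (fun x => 'd f x v) u w = 'd (fun x => 'd f x w) u v.
Proof.
move=> fs Uu; apply/rowP => j.
have E v' w' : 'd (fun x => 'd f x v') u w' 0 j =
    'd (fun x => 'd (fun y => f y 0 j : R^o) x v' : R^o) u w'.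
  have H := is_diff_coord j (smooth_is_diff (smooth_d v' fs) Uu).
  symmetry; apply: (is_diffE (df := fun w => 'd (fun x => 'd f x v') u w 0 j)).
  apply: is_diff_near_eq H; apply: filterS (near_open Uu) => y Uy.
  by rewrite d_coord//; case: (smooth_is_diff fs Uy).
by rewrite !E; apply: (schwarz v w Uo Uu); exact: (smooth_coord j fs).
Qed.

End Smooth.

(** * A torsion-free connection in a chart *)

Section TorsionFree.
Context {R : realType} {n : nat} (M : smooth_manifold R n) (D : pi_connection M)
  (i : chart_index M).
Local Notation U := (slit_dom i).
Local Notation rV := 'rV[R]_n.
Local Notation slit := (@slit_coord R n).

Lemma slit_dom_open : open U.
Proof.
have -> : U = (fst @^-1` (chart i @` chart_dom i)) `&` (snd @^-1` (~` [set 0])).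
  by apply/seteqP; split=> u [u1 /eqP u2].
apply: openI.
  apply: open_comp => [x _|]; [exact: cvg_fst|exact: chart_img_open].
apply: open_comp => [x _|]; first exact: cvg_snd.
apply: closed_openC; apply: accessible_closed_set1; apply: hausdorff_accessible.
exact: norm_hausdorff.
Qed.
Let Uo := slit_dom_open.

Lemma near_slit u : U u -> \forall v \near u, U v.
Proof. by move=> Uu; exact: near_open. Qed.

Lemma eta_smooth : smooth_on U (@eta R n).
Proof. exact: (smooth_snd Uo (smooth_id Uo)). Qed.

Definition conn_const (u w : slit) (z : rV) : rV := D i (fun=> w) (fun=> z) u.

Lemma conn_const_linearl u z : U u -> linear (fun w => conn_const u w z).
Proof.
move=> Uu a v w; rewrite /conn_const.
have S (b : slit) := smooth_cst Uo b; have Sz := smooth_cst Uo z.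
rewrite (conn_addl D (S (a *: v)) (S w) Sz Uu); congr (_ + _).
exact: (conn_scalel D (smooth_cst Uo (a : R^o)) (S v) Sz Uu).
Qed.

Lemma conn_const_linearr u w : U u -> linear (conn_const u w).
Proof.
move=> Uu a y z; rewrite /conn_const.
have S (b : rV) := smooth_cst Uo b; have Sw := smooth_cst Uo w.
rewrite (conn_addr D Sw (S (a *: y)) (S z) Uu); congr (_ + _).
rewrite (conn_leibniz D (smooth_cst Uo (a : R^o)) Sw (S y) Uu).
by rewrite /dir_deriv d_cst scale0r add0r.
Qed.

Lemma smooth_comb (W : normedModType R) m (f : 'I_m -> slit -> R) (e : 'I_m -> W)
    (s : seq 'I_m) :
  (forall j, smooth_on U (f j : slit -> R^o)) ->
  smooth_on U (fun v => \sum_(j <- s) f j v *: e j).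
Proof.
move=> fs; apply: (smooth_sum Uo) => j.
by apply: (smooth_scale Uo (fs j)); exact: smooth_cst.
Qed.

Lemma conn_suml m (f : 'I_m -> slit -> R) (e : 'I_m -> slit) Z u :
  (forall j, smooth_on U (f j : slit -> R^o)) -> smooth_on U Z -> U u ->
  D i (fun v => \sum_j f j v *: e j) Z u = \sum_j f j u *: D i (fun=> e j) Z u.
Proof.
move=> fs Zs Uu.
have D0 : D i (fun=> 0) Z u = 0.
  have /= := conn_scalel D (smooth_cst Uo (0 : R^o)) (smooth_cst Uo (0 : slit)) Zs Uu.
  by rewrite !scale0r.
have fes j : smooth_on U (fun v => f j v *: e j).
  by apply: (smooth_scale Uo (fs j)); exact: smooth_cst.
elim: (index_enum _) => [|j s IH].
  rewrite big_nil -[RHS]D0; congr (D i _ Z u).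
  by apply/funext => v; rewrite big_nil.
rewrite big_cons -IH -(conn_scalel D (fs j) (smooth_cst Uo (e j)) Zs Uu).
rewrite -(conn_addl D (fes j) (smooth_comb e s fs) Zs Uu).
by congr (D i _ Z u); apply/funext => v; rewrite big_cons.
Qed.

Lemma conn_sumr m (f : 'I_m -> slit -> R) (e : 'I_m -> rV) X u :
  (forall j, smooth_on U (f j : slit -> R^o)) -> smooth_on U X -> U u ->
  D i X (fun v => \sum_j f j v *: e j) u =
  \sum_j (dir_deriv X (f j) u *: e j + f j u *: D i X (fun=> e j) u).
Proof.
move=> fs Xs Uu.
have d0 : dir_deriv X (fun=> 0) u = 0 by rewrite /dir_deriv d_cst.
have D0 : D i X (fun=> 0) u = 0.
  have /= := conn_leibniz D (smooth_cst Uo (0 : R^o)) Xs (smooth_cst Uo (0 : rV)) Uu.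
  by rewrite !scale0r !scaler0 addr0.
have fes j : smooth_on U (fun v => f j v *: e j).
  by apply: (smooth_scale Uo (fs j)); exact: smooth_cst.
elim: (index_enum _) => [|j s IH].
  rewrite big_nil -[RHS]D0; congr (D i X _ u).
  by apply/funext => v; rewrite big_nil.
rewrite big_cons -IH -(conn_leibniz D (fs j) Xs (smooth_cst Uo (e j)) Uu).
rewrite -(conn_addr D Xs (fes j) (smooth_comb e s fs) Uu).
by congr (D i X _ u); apply/funext => v; rewrite big_cons.
Qed.

(** Both sides have the same expansion in the frame of constant fields, whose
coefficients only involve [X u]. *)
Lemma conn_at_point X Z u : smooth_on U X -> smooth_on U Z -> U u ->
  D i X Z u = D i (fun=> X u) Z u.
Proof.
move=> Xs Zs Uu.
have H Y : smooth_on U Y -> D i Y Z u =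
  \sum_j (Y u).1 0 j *: D i (fun=> (delta_mx 0 j, 0)) Z u +
  \sum_j (Y u).2 0 j *: D i (fun=> (0, delta_mx 0 j)) Z u.
  move=> Ys.
  have Y1 j : smooth_on U (fun v => (Y v).1 0 j : R^o).
    by exact: smooth_coord (smooth_fst Uo Ys).
  have Y2 j : smooth_on U (fun v => (Y v).2 0 j : R^o).
    by exact: smooth_coord (smooth_snd Uo Ys).
  rewrite -(conn_suml _ Y1 Zs Uu) -(conn_suml _ Y2 Zs Uu).
  rewrite -(conn_addl D (smooth_comb _ _ Y1) (smooth_comb _ _ Y2) Zs Uu).
  congr (D i _ Z u); apply/funext => v.
  rewrite [LHS]surjective_pairing; apply: injective_projections => /=.
    rewrite !raddf_sum/= [X in _ + X]big1 ?addr0; last by move=> j _; rewrite scaler0.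
    exact: row_sum_delta.
  rewrite !raddf_sum/= [X in X + _]big1 ?add0r; last by move=> j _; rewrite scaler0.
  exact: row_sum_delta.
by rewrite (H _ Xs) (H (fun=> X u)) //; exact: smooth_cst.
Qed.

Lemma connE X Z u : smooth_on U X -> smooth_on U Z -> U u ->
  D i X Z u = 'd Z u (X u) + conn_const u (X u) (Z u).
Proof.
move=> Xs Zs Uu.
have H Y : smooth_on U Y ->
    D i X Y u = 'd Y u (X u) + \sum_j Y u 0 j *: D i X (fun=> delta_mx 0 j) u.
  move=> Ys.
  have Yj j : smooth_on U (fun v => Y v 0 j : R^o) by exact: smooth_coord.
  have -> : D i X Y u = D i X (fun v => \sum_j Y v 0 j *: delta_mx 0 j) u.
    by congr (D i X _ u); apply/funext => v; exact: row_sum_delta.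
  rewrite (conn_sumr _ Yj Xs Uu) big_split/=; congr (_ + _).
  rewrite [RHS]row_sum_delta; apply: eq_bigr => j _; congr (_ *: _).
  rewrite /dir_deriv (d_coord)//; by case: (smooth_is_diff Ys Uu).
rewrite (H _ Zs); congr (_ + _).
rewrite /conn_const -(conn_at_point Xs (smooth_cst Uo (Z u)) Uu).
by rewrite (H _ (smooth_cst Uo (Z u))) d_cst add0r.
Qed.

Definition christoffel (u : slit) (v z : rV) : rV := conn_const u (v, 0) z.
Local Notation Gam := christoffel.

Lemma christoffel_smooth v z : smooth_on U (fun u => Gam u v z).
Proof. by apply: conn_smooth; exact: smooth_cst. Qed.

Lemma christoffel_linearr u v : U u -> linear (Gam u v).
Proof. exact: conn_const_linearr. Qed.

Hypothesis torsion_free : forall X Y, smooth_on U X -> smooth_on U Y ->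
  forall u, U u -> torsion D i X Y u = 0.

Lemma conn_const_swap u (w w' : slit) : U u ->
  conn_const u w w'.1 = conn_const u w' w.1.
Proof.
move=> Uu; have := torsion_free (smooth_cst Uo w) (smooth_cst Uo w') Uu.
rewrite /torsion.
have -> : lie_bracket (fun=> w) (fun=> w') u = 0.
  rewrite /lie_bracket; apply/eqP; rewrite subr_eq0; apply/eqP.
  by transitivity (0 : slit); [|symmetry]; apply: d_cst.
by rewrite /rho subr0; exact: subr0_eq.
Qed.

(** Exchanging the vertical vector [(0, a)] with [(z, 0)] turns the left-hand
side into the derivative of the zero field. *)
Lemma conn_const_vertical u a z : U u -> conn_const u (0, a) z = 0.
Proof.
move=> Uu; rewrite (@conn_const_swap u (0, a) (z, 0))//=.
have gl : linear (conn_const u (z, 0)) := conn_const_linearr (z, 0) Uu.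
by have := gl (-1) 0 0; rewrite !scaler0 addr0 scaleN1r addrC subrr.
Qed.

Lemma conn_christoffel X Z u : smooth_on U X -> smooth_on U Z -> U u ->
  D i X Z u = 'd Z u (X u) + Gam u (X u).1 (Z u).
Proof.
move=> Xs Zs Uu; rewrite connE//; congr (_ + _).
rewrite [X u]surjective_pairing (linear_pair _ _ (conn_const_linearl (Z u) Uu)).
by rewrite conn_const_vertical// addr0.
Qed.

Lemma christoffel_sym u v z : U u -> Gam u v z = Gam u z v.
Proof. exact: (@conn_const_swap u (v, 0) (z, 0)). Qed.

Lemma christoffel_linearl u z : U u -> linear (Gam u ^~ z).
Proof.
by move=> Uu a v w; rewrite !(christoffel_sym _ z Uu) (christoffel_linearr z Uu).
Qed.

Lemma christoffel0l u z : U u -> Gam u 0 z = 0.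
Proof.
move=> Uu; have := christoffel_linearl z Uu (-1) 0 0.
by rewrite !scaler0 addr0 scaleN1r addrC subrr.
Qed.

Lemma christoffel0r u z : U u -> Gam u z 0 = 0.
Proof. by move=> Uu; rewrite (christoffel_sym z 0 Uu) christoffel0l. Qed.

Lemma christoffelNr u a b : U u -> Gam u a (- b) = - Gam u a b.
Proof.
move=> Uu; have := christoffel_linearr a Uu (-1) b 0.
by rewrite !addr0 !scaleN1r christoffel0r// addr0.
Qed.

Lemma christoffelDr u x y z : U u -> Gam u x (y + z) = Gam u x y + Gam u x z.
Proof.
by move=> Uu; have := christoffel_linearr x Uu 1 y z; rewrite !scale1r.
Qed.

Lemma christoffelBl u x y z : U u -> Gam u (x - y) z = Gam u x z - Gam u y z.
Proof.
move=> Uu; have := christoffel_linearl z Uu (-1) y x.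
by rewrite !scaleN1r (addrC _ x) => ->; rewrite addrC.
Qed.

Lemma is_diff_christoffel_cst u x y : U u ->
  is_diff u (fun v => Gam v x y) ('d (fun v => Gam v x y) u).
Proof. by move=> Uu; exact: (smooth_is_diff (christoffel_smooth x y) Uu). Qed.

Lemma is_diff_christoffel u (Y dY Z dZ : slit -> rV) :
  U u -> is_diff u Y dY -> is_diff u Z dZ ->
  is_diff u (fun v => Gam v (Y v) (Z v))
    (fun w => 'd (fun v => Gam v (Y u) (Z u)) u w
              + Gam u (dY w) (Z u) + Gam u (Y u) (dZ w)).
Proof.
move=> Uu Yd Zd.
have H e : is_diff u (fun v => Gam v (Y v) e)
    (fun w => 'd (fun v => Gam v (Y u) e) u w + Gam u (dY w) e).
  apply: is_diff_contract (fun y => is_diff_christoffel_cst y e Uu) Yd.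
  by apply: filterS (near_slit Uu) => v; exact: christoffel_linearl.
apply: (@is_diff_contract _ _ _ _ (fun v => Gam v (Y v)) _ _ _ u _ H Zd).
by apply: filterS (near_slit Uu) => v; exact: christoffel_linearr.
Qed.

Lemma christoffel_field_smooth (Y Z : slit -> rV) :
  smooth_on U Y -> smooth_on U Z -> smooth_on U (fun v => Gam v (Y v) (Z v)).
Proof.
move=> Ys Zs; apply: (smooth_contract Uo (F := fun v => Gam v (Y v))) => //.
  by move=> v; exact: christoffel_linearr.
move=> e; apply: (smooth_contract Uo (F := fun v => Gam v ^~ e)) => //.
  by move=> v; exact: christoffel_linearl.
by move=> e'; exact: christoffel_smooth.
Qed.

Lemma horizontalE u w : U u -> horizontal D i u w <-> w.2 = - Gam u w.1 u.2.
Proof.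
move=> Uu; rewrite /horizontal /=.
rewrite (conn_christoffel (smooth_cst Uo w) eta_smooth Uu).
have -> : 'd (@eta R n) u w = w.2.
  by exact: (is_diffE w (is_diff_snd (is_diff_id u))).
split=> [/eqP|->]; last by rewrite addNr.
by rewrite addr_eq0 => /eqP.
Qed.

Lemma betaE u v : U u -> beta D i u v = (v, - Gam u v u.2).
Proof.
move=> Uu; apply: xget_unique => /=; first by split=> //; apply/horizontalE.
by move=> [w1 w2] [/(horizontalE _ Uu)/= -> ->].
Qed.

(** * The curvature in a chart *)

Lemma lie_bracket_smooth (X Y : slit -> slit) :
  smooth_on U X -> smooth_on U Y -> smooth_on U (lie_bracket X Y).
Proof.
move=> Xs Ys.
have H (A B : slit -> slit) : smooth_on U A -> smooth_on U B ->
    smooth_on U (fun v => 'd A v (B v)).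
  move=> As Bs; apply: (smooth_contract_pair Uo (F := fun v => 'd A v)) => //.
    by move=> v _; exact: linearP.
  by move=> e; exact: smooth_d.
exact: (smoothD Uo (H _ _ Ys Xs) (smoothN Uo (H _ _ Xs Ys))).
Qed.

Lemma is_diff_conn (Y : slit -> slit) (Z : slit -> rV) u :
  smooth_on U Y -> smooth_on U Z -> U u ->
  is_diff u (D i Y Z) (fun w =>
    'd (fun v => 'd Z v (Y u)) u w + 'd Z u ('d Y u w) +
    ('d (fun v => Gam v (Y u).1 (Z u)) u w
     + Gam u ('d Y u w).1 (Z u) + Gam u (Y u).1 ('d Z u w))).
Proof.
move=> Ys Zs Uu.
apply: (@is_diff_near_eq _ _ _ (fun v => 'd Z v (Y v) + Gam v (Y v).1 (Z v))).
  by apply: filterS (near_slit Uu) => v Uv; rewrite conn_christoffel.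
have Yd := smooth_is_diff Ys Uu; have Zd := smooth_is_diff Zs Uu.
apply: is_diffD; last exact: (is_diff_christoffel Uu (is_diff_fst Yd) Zd).
have Fl : \forall v \near u, linear (fun e => 'd Z v e).
  by apply: filterS (near_slit Uu) => v _; exact: linearP.
have Fd e := smooth_is_diff (smooth_d e Zs) Uu.
exact: (is_diff_contract_pair Fl Fd Yd).
Qed.

(* The regrouping of the terms of the curvature, with [a1] and [a1'] the second
   derivatives of Z, and [c], [g] the terms of the Lie bracket. *)
Let curvature_regroup m (a1 a1' a2 a3 a4 a5 a6 a7 a8 a9 b1 b2 c g : 'rV[R]_m) :
  a1 = a1' -> c = a2 - a3 -> g = a6 - a7 ->
  - (a1 + a2 + (a4 + a6 + a8) + (a9 + b2)) + (a1' + a3 + (a5 + a7 + a9) + (a8 + b1))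
  + (c + g) = - a4 + a5 - b2 + b1.
Proof.
move=> -> -> ->; apply/rowP => j; rewrite !mxE.
move: (a1' 0 j) (a2 0 j) (a3 0 j) (a4 0 j) (a5 0 j) (a6 0 j) (a7 0 j) (a8 0 j).
by move: (a9 0 j) (b1 0 j) (b2 0 j) => *; ring.
Qed.

(** Tensoriality of the curvature in its three arguments: all derivatives of
[X], [Y] and [Z] cancel, those of second order by Schwarz's theorem. *)
Lemma curvatureE X Y Z u :
  smooth_on U X -> smooth_on U Y -> smooth_on U Z -> U u ->
  curvature D i X Y Z u =
  - 'd (fun v => Gam v (Y u).1 (Z u)) u (X u)
  + 'd (fun v => Gam v (X u).1 (Z u)) u (Y u)
  - Gam u (X u).1 (Gam u (Y u).1 (Z u)) + Gam u (Y u).1 (Gam u (X u).1 (Z u)).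
Proof.
move=> Xs Ys Zs Uu.
rewrite /curvature.
have conn2 A B : smooth_on U A -> smooth_on U B -> D i A (D i B Z) u =
    'd (fun v => 'd Z v (B u)) u (A u) + 'd Z u ('d B u (A u)) +
    ('d (fun v => Gam v (B u).1 (Z u)) u (A u)
     + Gam u ('d B u (A u)).1 (Z u) + Gam u (B u).1 ('d Z u (A u)))
    + (Gam u (A u).1 ('d Z u (B u)) + Gam u (A u).1 (Gam u (B u).1 (Z u))).
  move=> As Bs; rewrite (conn_christoffel As (conn_smooth D Bs Zs) Uu).
  congr (_ + _); first exact: (is_diffE (A u) (is_diff_conn Bs Zs Uu)).
  by rewrite (conn_christoffel Bs Zs Uu) christoffelDr.
rewrite (conn2 X Y Xs Ys) (conn2 Y X Ys Xs).
rewrite (conn_christoffel (lie_bracket_smooth Xs Ys) Zs Uu).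
have schw := schwarz_row Uo (Y u) (X u) Zs Uu.
have dZB : 'd Z u (lie_bracket X Y u) = 'd Z u ('d Y u (X u)) - 'd Z u ('d X u (Y u)).
  exact: (linearB ('d Z u)).
have GB : Gam u (lie_bracket X Y u).1 (Z u) =
    Gam u ('d Y u (X u)).1 (Z u) - Gam u ('d X u (Y u)).1 (Z u).
  exact: christoffelBl.
exact: (curvature_regroup _ _ _ _ _ _ schw dZB GB).
Qed.

Definition nonlinear (v : rV) (u : slit) : rV := Gam u v u.2.

Definition hlift (u : slit) (v : rV) : slit := (v, - nonlinear v u).

(** The right-hand side of [curvatureE] for the horizontal lifts of [x] and
[y]: the h-curvature as a function of the point and of three vectors. *)
Definition rcurv (u : slit) (x y z : rV) : rV :=
  - 'd (fun v => Gam v y z) u (hlift u x) + 'd (fun v => Gam v x z) u (hlift u y)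
  - Gam u x (Gam u y z) + Gam u y (Gam u x z).

Lemma nonlinear_smooth x : smooth_on U (nonlinear x).
Proof. exact: (christoffel_field_smooth (smooth_cst Uo x) eta_smooth). Qed.

Lemma beta_field_smooth X : smooth_on U X -> smooth_on U (beta_field D i X).
Proof.
move=> Xs; have Ns := christoffel_field_smooth Xs eta_smooth.
apply: (smooth_eq Uo _ (smooth_pair Uo Xs (smoothN Uo Ns))) => u Uu.
by rewrite /beta_field betaE.
Qed.

Lemma hcurvatureE X Y Z u :
  smooth_on U X -> smooth_on U Y -> smooth_on U Z -> U u ->
  hcurvature D i X Y Z u = rcurv u (X u) (Y u) (Z u).
Proof.
move=> Xs Ys Zs Uu; rewrite /hcurvature.
rewrite (curvatureE (beta_field_smooth Xs) (beta_field_smooth Ys) Zs Uu).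
by rewrite /beta_field !betaE.
Qed.

Lemma hlift_linear u : U u -> linear (hlift u).
Proof.
move=> Uu a x y; apply: injective_projections => //=.
by rewrite /nonlinear (christoffel_linearl u.2 Uu) opprD scalerN.
Qed.

Lemma d_christoffel_linearl u z w : U u ->
  linear (fun x => 'd (fun v => Gam v x z) u w).
Proof.
move=> Uu a x y.
have H := is_diffD (is_diffZ a (is_diff_christoffel_cst x z Uu))
  (is_diff_christoffel_cst y z Uu).
have H2 : is_diff u (fun v => Gam v (a *: x + y) z)
  (a *: ('d (fun v => Gam v x z) u : slit -> rV) + 'd (fun v => Gam v y z) u).
  apply: is_diff_near_eq H; apply: filterS (near_slit Uu) => v Uv.
  by rewrite (christoffel_linearl z Uv).
exact: (is_diffE w H2).
Qed.

Lemma d_christoffel_sym u x z w : U u ->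
  'd (fun v => Gam v x z) u w = 'd (fun v => Gam v z x) u w.
Proof.
move=> Uu; apply: is_diffE; apply: is_diff_near_eq (is_diff_christoffel_cst z x Uu).
by apply: filterS (near_slit Uu) => v Uv; rewrite christoffel_sym.
Qed.

Let rcurv_comb m (a : R) (A B C E a1 a2 b1 b2 c1 c2 e1 e2 : 'rV[R]_m) :
  A = a *: a1 + a2 -> B = a *: b1 + b2 -> C = a *: c1 + c2 -> E = a *: e1 + e2 ->
  - A + B - C + E = a *: (- a1 + b1 - c1 + e1) + (- a2 + b2 - c2 + e2).
Proof. by move=> -> -> -> ->; apply/rowP => j; rewrite !mxE; ring. Qed.

Lemma rcurv_linearl u y z : U u -> linear (fun x => rcurv u x y z).
Proof.
move=> Uu a x x'; rewrite /rcurv.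
have E1 : 'd (fun v => Gam v y z) u (hlift u (a *: x + x')) =
    a *: 'd (fun v => Gam v y z) u (hlift u x) + 'd (fun v => Gam v y z) u (hlift u x').
  by rewrite (hlift_linear Uu a x x'); exact: linearP.
have E2 := d_christoffel_linearl z (hlift u y) Uu a x x'.
have E3 := christoffel_linearl (Gam u y z) Uu a x x'.
have E4 : Gam u y (Gam u (a *: x + x') z) =
    a *: Gam u y (Gam u x z) + Gam u y (Gam u x' z).
  by rewrite (christoffel_linearl z Uu) (christoffel_linearr y Uu).
exact: (rcurv_comb E1 E2 E3 E4).
Qed.

Let rcurv_swap m (A B C E : 'rV[R]_m) : - A + B - C + E = - (- B + A - E + C).
Proof. by apply/rowP => j; rewrite !mxE; ring. Qed.

Lemma rcurv_anti u x y z : rcurv u x y z = - rcurv u y x z.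
Proof. exact: rcurv_swap. Qed.

Let rcurv_cycle m (A A' B B' C C' P P' Q Q' S S' : 'rV[R]_m) :
  A = A' -> B = B' -> C = C' -> P = P' -> Q = Q' -> S = S' ->
  - A + B' - P + Q' + (- B + C' - Q + S') + (- C + A' - S + P') = 0.
Proof. by do 6![move->]; apply/rowP => j; rewrite !mxE; ring. Qed.

(** A consequence of the symmetry of [christoffel] alone: the terms cancel in
pairs. *)
Lemma bianchi u x y z : U u -> rcurv u x y z + rcurv u y z x + rcurv u z x y = 0.
Proof.
move=> Uu; rewrite /rcurv.
have e1 := d_christoffel_sym y z (hlift u x) Uu.
have e2 := d_christoffel_sym z x (hlift u y) Uu.
have e3 := d_christoffel_sym x y (hlift u z) Uu.
have s1 := congr1 (Gam u x) (christoffel_sym y z Uu).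
have s2 := congr1 (Gam u y) (christoffel_sym z x Uu).
have s3 := congr1 (Gam u z) (christoffel_sym x y Uu).
exact: (rcurv_cycle e1 e2 e3 s1 s2 s3).
Qed.

Lemma d_nonlinear x u w : U u ->
  'd (nonlinear x) u w = 'd (fun v => Gam v x u.2) u w + Gam u x w.2.
Proof.
move=> Uu.
have H : is_diff u (nonlinear x)
    (fun w => 'd (fun v => Gam v x u.2) u w + Gam u 0 u.2 + Gam u x w.2).
  exact: (is_diff_christoffel Uu (is_diff_cst x u) (is_diff_snd (is_diff_id u))).
apply: eq_trans (is_diffE w H) _.
by rewrite christoffel0l// addr0.
Qed.

Let rcurv_sub m (X Y A B P Q : 'rV[R]_m) :
  X = B - P -> Y = A - Q -> - A + B - P + Q = X - Y.
Proof. by move=> -> ->; apply/rowP => j; rewrite !mxE; ring. Qed.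

(** With the present sign of the curvature, the (v)h-torsion is the bracket of
the horizontal lifts of the constant fields [x] and [y], a vertical vector which
measures the non-integrability of the horizontal distribution. *)
Lemma rcurv_eta u x y : U u ->
  rcurv u x y u.2 = 'd (nonlinear x) u (hlift u y) - 'd (nonlinear y) u (hlift u x).
Proof.
move=> Uu.
have E a b : 'd (nonlinear a) u (hlift u b) =
    'd (fun v => Gam v a u.2) u (hlift u b) - Gam u a (Gam u b u.2).
  apply: eq_trans (d_nonlinear a (hlift u b) Uu) _; congr (_ + _).
  exact: christoffelNr.
exact: (rcurv_sub (E x y) (E y x)).
Qed.

(** * The h-curvature of a Berwald connection as a derivative *)

Hypothesis vhv_torsion_free : forall X Y, smooth_on U X -> smooth_on U Y ->
  forall u, U u -> vhv_torsion D i X Y u = 0.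

Let vanish m (A B C E : 'rV[R]_m) :
  - A + B - C + E = 0 -> A = 0 -> C = 0 -> E = 0 -> B = 0.
Proof.
by move=> H A0 C0 E0; move: H; rewrite A0 C0 E0 oppr0 add0r !addr0.
Qed.

Lemma d_christoffel_eta_vert u a b : U u -> 'd (fun v => Gam v a u.2) u (gam b) = 0.
Proof.
move=> Uu; have as_ := smooth_cst Uo a; have bs := smooth_cst Uo b.
have K0 := vhv_torsion_free as_ bs Uu.
have gs : smooth_on U (gam_field (fun=> b)).
  exact: (smooth_pair Uo (smooth_cst Uo (0 : rV)) bs).
have K1 := curvatureE (beta_field_smooth as_) gs eta_smooth Uu.
have b1 : (beta_field D i (fun=> a) u).1 = a by rewrite /beta_field betaE.
have D0 w : 'd (fun v => Gam v 0 u.2) u w = 0.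
  apply: (@is_diffE _ _ _ _ (fun=> 0)).
  apply: is_diff_near_eq (is_diff_cst (0 : rV) u).
  by apply: filterS (near_slit Uu) => v Uv; rewrite christoffel0l.
have D1 := congr1 (fun t => 'd (fun v => Gam v t u.2) u (gam b)) b1.
apply: eq_trans (esym D1) _.
apply: (vanish (eq_trans (esym K1) K0)); first exact: D0.
- exact: (eq_trans (congr1 (Gam u _) (christoffel0l _ Uu)) (christoffel0r _ Uu)).
- exact: christoffel0l.
Qed.

(** The defining feature of the Berwald connection: its coefficients are the
vertical derivatives of the nonlinear connection. *)
Lemma d_nonlinear_vert u a b : U u -> 'd (nonlinear a) u (gam b) = Gam u a b.
Proof.
move=> Uu; apply: eq_trans (d_nonlinear a (gam b) Uu) _.
by rewrite d_christoffel_eta_vert// add0r.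
Qed.

Lemma is_diff_nonlinear_hlift u x y : U u ->
  is_diff u (fun v => 'd (nonlinear x) v (hlift v y))
    (fun w => 'd (fun v => 'd (nonlinear x) v (hlift u y)) u w
       + 'd (nonlinear x) u (0, - 'd (nonlinear y) u w)).
Proof.
move=> Uu.
have Fl : \forall v \near u, linear (fun e => 'd (nonlinear x) v e).
  by apply: filterS (near_slit Uu) => v _; exact: linearP.
have Fd e := smooth_is_diff (smooth_d e (nonlinear_smooth x)) Uu.
have Nd := smooth_is_diff (nonlinear_smooth y) Uu.
have hd : is_diff u (fun v => hlift v y) (fun w => (0, - 'd (nonlinear y) u w)).
  exact: (is_diff_pair (is_diff_cst y u) (is_diffN Nd)).
exact: (is_diff_contract_pair Fl Fd hd).
Qed.

(** By Schwarz's theorem the vertical derivative may be taken first, where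
[d_nonlinear_vert] applies; the last term comes from the variation of the
horizontal lift. *)
Lemma d_nonlinear_hlift_vert u x y z : U u ->
  'd (fun v => 'd (nonlinear x) v (hlift v y)) u (gam z) =
  'd (fun v => Gam v x z) u (hlift u y) - Gam u x (Gam u y z).
Proof.
move=> Uu; apply: eq_trans (is_diffE (gam z) (is_diff_nonlinear_hlift x y Uu)) _.
congr (_ + _).
  apply: eq_trans (schwarz_row Uo (hlift u y) (gam z) (nonlinear_smooth x) Uu) _.
  apply: is_diffE; apply: is_diff_near_eq (is_diff_christoffel_cst x z Uu).
  by apply: filterS (near_slit Uu) => v Uv; rewrite d_nonlinear_vert.
pose dN t := 'd (nonlinear x) u (0, - t).
apply: eq_trans (congr1 dN (d_nonlinear_vert y z Uu)) _.
apply: eq_trans (d_nonlinear_vert x (- Gam u y z) Uu) _.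
exact: christoffelNr.
Qed.

Lemma is_diff_rcurv_eta u x y : U u ->
  exists2 df, is_diff u (fun v => rcurv v x y v.2) df &
              forall z, df (gam z) = rcurv u x y z.
Proof.
move=> Uu.
have H := is_diffB (is_diff_nonlinear_hlift x y Uu) (is_diff_nonlinear_hlift y x Uu).
have H2 := is_diff_near_eq (g := fun v => rcurv v x y v.2) _ H.
eexists.
  by apply: H2; apply: filterS (near_slit Uu) => v Uv; rewrite rcurv_eta.
have E x' y' z := eq_trans (esym (is_diffE (gam z) (is_diff_nonlinear_hlift x' y' Uu)))
  (d_nonlinear_hlift_vert x' y' z Uu).
move=> z; exact: (esym (rcurv_sub (E x y z) (E y x z))).
Qed.

Lemma d_rcurv_eta u x y z : U u ->
  'd (fun v => rcurv v x y v.2) u (gam z) = rcurv u x y z.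
Proof.
move=> Uu; have [df H <-] := is_diff_rcurv_eta x y Uu; exact: is_diffE.
Qed.

Lemma d_deviation u x z : U u ->
  'd (fun v => rcurv v v.2 x v.2) u (gam z) = rcurv u u.2 x z + rcurv u z x u.2.
Proof.
move=> Uu.
have Fl : \forall v \near u, linear (fun e => rcurv v e x v.2).
  by apply: filterS (near_slit Uu) => v Uv; exact: rcurv_linearl.
have Fd e : is_diff u (fun v => rcurv v e x v.2) ('d (fun v => rcurv v e x v.2) u).
  by apply: differentiableP; have [df [H _] _] := is_diff_rcurv_eta e x Uu.
have H := is_diff_contract Fl Fd (is_diff_snd (is_diff_id u)).
apply: eq_trans (is_diffE (gam z) H) _.
by congr (_ + _); exact: d_rcurv_eta.
Qed.

Let triple m (a b b' c c' : 'rV[R]_m) :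
  a + b' + c' = 0 -> b' = - b -> c' = - c -> (a + b) - (c + b') = 3%:R *: b.
Proof.
move=> + bE cE; rewrite bE cE => /(canRL (subrK _))/(canRL (subrK _)) ->.
by apply/rowP => j; rewrite !mxE; ring.
Qed.

(** The deviation tensor determines the (v)h-torsion. By [d_deviation] the
left-hand side is twice the torsion on the right plus
R(eta, x)z - R(eta, z)x, which the Bianchi identity turns into a third copy. *)
Lemma rcurv_eta_deviation u x z : U u ->
  'd (fun v => rcurv v v.2 x v.2) u (gam z) - 'd (fun v => rcurv v v.2 z v.2) u (gam x)
  = 3%:R *: rcurv u z x u.2.
Proof.
move=> Uu.
apply: eq_trans
  (f_equal2 (fun a b => a - b) (d_deviation x z Uu) (d_deviation z x Uu)) _.
exact: (triple (bianchi u.2 x z Uu) (rcurv_anti _ _ _ _) (rcurv_anti _ _ _ _)).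
Qed.

End TorsionFree.

(** * The Finsler metric and its energy *)

Section Finsler.
Context {R : realType} {n : nat} (M : smooth_manifold R n) (L : finsler_structure M)
  (i : chart_index M).
Local Notation U := (slit_dom i).
Local Notation rV := 'rV[R]_n.
Local Notation slit := (@slit_coord R n).
Let Uo := @slit_dom_open R n M i.
Local Notation g := (gmetric L i).

(** Twice the usual energy: [gmetric] is half its vertical Hessian. *)
Definition energy (u : slit) : R^o := L i u ^+ 2.

Lemma energy_smooth : smooth_on U energy.
Proof.
have [Ls _] := finsler_smooth L.
apply: (smooth_eq Uo _ (smooth_scale Uo (Ls i) (Ls i))) => u _.
by rewrite /energy expr2.
Qed.

Lemma gam_linear : linear (@gam R n).
Proof. by move=> a v w; apply: injective_projections => //=; rewrite scaler0 addr0. Qed.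

Lemma gmetric_sym u v w : U u -> g u v w = g u w v.
Proof.
move=> Uu; congr (_ * _).
exact: (schwarz (gam w) (gam v) Uo Uu (energy_smooth 2)).
Qed.

Lemma gmetricDl u a v v' w : g u (a *: v + v') w = a * g u v w + g u v' w.
Proof.
pose d v := 'd (fun x => 'd energy x (gam w) : R^o) u (gam v).
have E : d (a *: v + v') = a * d v + d v'.
  by apply: eq_trans (congr1 _ (gam_linear a v v')) _; exact: linearP.
apply: eq_trans (congr1 (fun t => 2^-1 * t) E) _.
by rewrite mulrDr mulrCA.
Qed.

Lemma gmetricZl u a v w : g u (a *: v) w = a * g u v w.
Proof.
have g0 : g u 0 w = 0.
  by have := gmetricDl u (-1) 0 0 w; rewrite scaler0 addr0 mulN1r addNr.
by rewrite -[a *: v]addr0 gmetricDl g0 addr0.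
Qed.

Lemma gmetricBl u v v' w : g u (v - v') w = g u v w - g u v' w.
Proof. by rewrite addrC -scaleN1r gmetricDl mulN1r addrC. Qed.

Lemma gmetric_comb u k a b x y w :
  g u (k *: (a *: x - b *: y)) w = k * (a * g u x w - b * g u y w).
Proof. by rewrite gmetricZl gmetricBl !gmetricZl. Qed.

Lemma is_diff_energy u : U u -> is_diff u energy ('d energy u).
Proof. exact: smooth_is_diff energy_smooth. Qed.

Lemma is_diff_d_energy u v : U u ->
  is_diff u (fun y => 'd energy y v : R^o) ('d (fun y => 'd energy y v : R^o) u).
Proof. by move=> Uu; exact: (smooth_is_diff (smooth_d v energy_smooth) Uu). Qed.

Lemma d_energy_gam_linear u : linear (fun e => 'd energy u (gam e) : R^o).
Proof.
by move=> a b c; apply: eq_trans (congr1 _ (gam_linear a b c)) _; exact: linearP.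
Qed.

(** Euler's identity for the 2-homogeneous function [energy], by
differentiation at [t = 1] of its restriction to the ray [t *: u.2]. *)
Lemma euler_energy u : U u -> 'd energy u (gam u.2) = 2 * energy u.
Proof.
move=> Uu.
have u1 : (u.1, (1 : R) *: u.2) = u by rewrite scale1r -surjective_pairing.
pose c (t : R) : slit := (u.1, t *: u.2).
have cd : is_diff (1 : R) c (fun s => (0, s *: u.2)).
  exact: (is_diff_pair (is_diff_cst u.1 (1 : R)) (is_diff_scalel (1 : R) u.2)).
have Ed : is_diff (c 1) energy ('d energy u).
  by rewrite /c u1; exact: is_diff_energy.
have H1 := is_diff_comp cd Ed.
pose dq (w : R^o) : R^o := 1 *: (w *: energy u) + w *: (1 *: energy u).
have H2 : is_diff (1 : R) (fun t : R^o => t *: (t *: energy u : R^o)) dq.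
  exact: (is_diff_scale (is_diff_id (1 : R^o)) (is_diff_scalel (1 : R) (energy u))).
have H3 : is_diff (1 : R) (energy \o c) dq.
  apply: is_diff_near_eq H2.
  have : \forall t \near (1 : R), 0 < t by apply: lt_nbhsr.
  apply: filterS => t t0 /=.
  by rewrite /energy (finsler_homogeneous L Uu t0) expr1 exprMn expr2 -mulrA.
have := eq_trans (esym (is_diffE (1 : R) H1)) (is_diffE (1 : R) H3).
by rewrite /dq /= !scale1r => ->; rewrite mulr_natl mulr2n.
Qed.

(** Differentiating Euler's identity of [energy] along [gam x] shows that the
vertical derivative of [energy] is 1-homogeneous. *)
Lemma gmetric_eta u x : U u -> g u u.2 x = 2^-1 * 'd energy u (gam x).
Proof.
move=> Uu; rewrite gmetric_sym//; congr (_ * _).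
change ('d (fun v => 'd energy v (gam u.2) : R^o) u (gam x) = 'd energy u (gam x)).
have Fl : \forall v \near u, linear (fun e => 'd energy v (gam e) : R^o).
  by apply: filterS (near_slit Uu) => v _; exact: d_energy_gam_linear.
have Fd e := is_diff_d_energy (gam e) Uu.
have H := is_diff_contract Fl Fd (is_diff_snd (is_diff_id u)).
have H2 : is_diff u (fun v => 'd energy v (gam v.2) : R^o)
    (2 *: ('d energy u : slit -> R^o)).
  apply: is_diff_near_eq (is_diffZ 2 (is_diff_energy Uu)).
  by apply: filterS (near_slit Uu) => v Uv; rewrite euler_energy.
have := eq_trans (esym (is_diffE (gam x) H)) (is_diffE (gam x) H2).
rewrite !fctE => E; apply: (addIr ('d energy u (gam x))).
apply: eq_trans E _.
by rewrite -[LHS]/(2 * _) mulr_natl mulr2n.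
Qed.

Lemma finsler_neq0 u : U u -> L i u != 0.
Proof. by move=> Uu; rewrite gt_eqF// finsler_pos. Qed.

Lemma phiE u x : phi L i u x = x - ((L i u)^-1 * ((L i u)^-1 * g u u.2 x)) *: u.2.
Proof. by []. Qed.

Lemma phi_smooth X : smooth_on U X -> smooth_on U (phi_field L i X).
Proof.
move=> Xs; have [Ls _] := finsler_smooth L.
have is_ : smooth_on U (fun u => (L i u)^-1 : R^o).
  by apply: (smooth_inv Uo) => //; exact: finsler_neq0.
have gs : smooth_on U (fun u => 2^-1 *: ('d energy u (gam (X u)) : R^o)).
  apply: (smooth_scale Uo (smooth_cst Uo (2^-1 : R^o))).
  apply: (smooth_contract Uo (F := fun u e => 'd energy u (gam e) : R^o)) => //.
    by move=> v _; exact: d_energy_gam_linear.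
  by move=> e; exact: (smooth_d (gam e) energy_smooth).
have cs := smooth_scale Uo is_ (smooth_scale Uo is_ gs).
have ps := smoothD Uo Xs (smoothN Uo (smooth_scale Uo cs (@eta_smooth _ _ _ i))).
by apply: (smooth_eq Uo _ ps) => u Uu; rewrite /phi_field phiE gmetric_eta.
Qed.

(** [phi] is the projection onto the g-orthogonal complement of [eta], because
g(eta, eta) is [energy]. *)
Lemma gmetric_phi u x y : U u -> g u (phi L i u x) (phi L i u y) = angular L i u x y.
Proof.
move=> Uu; have L0 := finsler_neq0 Uu.
have gee : g u u.2 u.2 = L i u ^+ 2.
  by rewrite gmetric_eta// euler_energy// mulKf// pnatr_eq0.
have phiZ v : phi L i u v = (- ((L i u)^-1 * ((L i u)^-1 * g u u.2 v))) *: u.2 + v.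
  by rewrite phiE scaleNr addrC.
rewrite !phiZ gmetricDl !(gmetric_sym _ (_ *: _ + _) Uu) !gmetricDl gee.
rewrite /angular /ell (gmetric_sym y x Uu) (gmetric_sym y u.2 Uu).
move: (g u u.2 x) (g u u.2 y) (g u x y) => a b c.
by field.
Qed.

(** * Finsler manifolds of constant curvature *)

Context (D : pi_connection M) (k : R).
Hypothesis torsion_free : forall X Y, smooth_on U X -> smooth_on U Y ->
  forall u, U u -> torsion D i X Y u = 0.
Hypothesis vhv_torsion_free : forall X Y, smooth_on U X -> smooth_on U Y ->
  forall u, U u -> vhv_torsion D i X Y u = 0.
Hypothesis deviation_phi : forall X, smooth_on U X ->
  forall u, U u -> deviation D i X u = (k * L i u ^+ 2) *: phi L i u (X u).

Lemma rcurv_deviation u x : U u -> rcurv D i u u.2 x u.2 =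
  k *: (energy u *: x - (2^-1 * 'd energy u (gam x)) *: u.2).
Proof.
move=> Uu; have L0 := finsler_neq0 Uu.
have es := @eta_smooth R n M i; have xs := smooth_cst Uo x.
apply: eq_trans (esym (hcurvatureE torsion_free es xs es Uu)) _.
apply: eq_trans (deviation_phi xs Uu) _.
rewrite phiE gmetric_eta// -scalerA; congr (_ *: _).
rewrite scalerBr scalerA; congr (_ - _ *: _).
by rewrite -/(energy u) /energy; field.
Qed.

Lemma d_rcurv_deviation u x z : U u ->
  'd (fun v => rcurv D i v v.2 x v.2) u (gam z) =
  k *: ('d energy u (gam z) *: x - ((2^-1 * 'd energy u (gam x)) *: z + g u z x *: u.2)).
Proof.
move=> Uu.
have H1 := is_diff_scale (is_diff_energy Uu) (is_diff_cst x u).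
have H2 := is_diff_scale (is_diffZ 2^-1 (is_diff_d_energy (gam x) Uu))
  (is_diff_snd (is_diff_id u)).
have H3 := is_diffZ k (is_diffB H1 H2).
have H4 := is_diff_near_eq (g := fun v => rcurv D i v v.2 x v.2) _ H3.
apply: eq_trans (is_diffE (gam z) (H4 _)) _.
  by apply: filterS (near_slit Uu) => v Uv; rewrite (rcurv_deviation x Uv).
by rewrite !fctE scaler0 add0r.
Qed.

Let third (a b c c' : R) (r x y z : rV) :
  k *: (a *: x - ((2^-1 * b) *: z + c *: y))
    - k *: (b *: z - ((2^-1 * a) *: x + c' *: y)) = 3%:R *: r ->
  c = c' -> r = (2^-1 * k) *: (a *: x - b *: z).
Proof.
move=> H cc; have t0 : (3%:R : R) != 0 by rewrite pnatr_eq0.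
apply: (scalerI t0); rewrite -H cc; apply/rowP => j; rewrite !mxE.
by field.
Qed.

Lemma rcurv_eta_energy u x z : U u -> rcurv D i u z x u.2 =
  (2^-1 * k) *: ('d energy u (gam z) *: x - 'd energy u (gam x) *: z).
Proof.
move=> Uu.
have E := rcurv_eta_deviation torsion_free vhv_torsion_free x z Uu.
have E2 := f_equal2 (fun a b => a - b)
  (d_rcurv_deviation x z Uu) (d_rcurv_deviation z x Uu).
exact: (third (eq_trans (esym E2) E) (gmetric_sym z x Uu)).
Qed.

Let half (a b : R) (x z : rV) :
  (2^-1 * k) *: (a *: x - b *: z) = k *: ((2^-1 * a) *: x - (2^-1 * b) *: z).
Proof. by apply/rowP => j; rewrite !mxE; ring. Qed.

(** The vertical derivative along [w] of [rcurv_eta_energy]. *)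
Lemma rcurv_gmetric u x z w : U u ->
  rcurv D i u z x w = k *: (g u w z *: x - g u w x *: z).
Proof.
move=> Uu.
apply: eq_trans (esym (d_rcurv_eta torsion_free vhv_torsion_free z x w Uu)) _.
have H1 := is_diff_scale (is_diff_d_energy (gam z) Uu) (is_diff_cst x u).
have H2 := is_diff_scale (is_diff_d_energy (gam x) Uu) (is_diff_cst z u).
have H3 := is_diffZ (2^-1 * k) (is_diffB H1 H2).
have H4 := is_diff_near_eq (g := fun v => rcurv D i v z x v.2) _ H3.
apply: eq_trans (is_diffE (gam w) (H4 _)) _.
  by apply: filterS (near_slit Uu) => v Uv; rewrite (rcurv_eta_energy x z Uv).
rewrite !fctE !scaler0 !add0r.
exact: half.
Qed.

Lemma Pproj4_hcurvature4 X Y Z W u :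
  smooth_on U X -> smooth_on U Y -> smooth_on U Z -> U u ->
  Pproj4 L i (hcurvature4 L D i) X Y Z W u =
  k * alternate (fun X' Y' v =>
        angular L i v (X' v) (Z v) * angular L i v (Y' v) (W v)) X Y u.
Proof.
move=> Xs Ys Zs Uu; rewrite /Pproj4 /hcurvature4 /alternate.
have H := hcurvatureE torsion_free (phi_smooth Xs) (phi_smooth Ys) (phi_smooth Zs) Uu.
have H2 := eq_trans H
  (rcurv_gmetric (phi L i u (Y u)) (phi L i u (X u)) (phi L i u (Z u)) Uu).
apply: eq_trans (congr1 (fun t => g u t (phi L i u (W u))) H2) _.
apply: eq_trans (gmetric_comb _ _ _ _ _ _ _) _.
have A x y := gmetric_phi x y Uu.
have As x y : g u (phi L i u x) (phi L i u y) = angular L i u y x.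
  exact: (eq_trans (gmetric_sym _ _ Uu) (A y x)).
exact: (f_equal4 (fun a b c d => k * (a * b - c * d))
  (As (Z u) (X u)) (A (Y u) (W u)) (As (Z u) (Y u)) (A (X u) (W u))).
Qed.

End Finsler.

Theorem proposition3p2 (R : realType) (n : nat) (M : smooth_manifold R n)
    (L : finsler_structure M) (D : pi_connection M) (k : R) :
  (4 <= n)%N -> is_berwald L D ->
  constant_curvature L D k -> Hp_constant_curvature L D k.
Proof.
move=> n4 [_ tf vf _] [_ ks kh dev]; split=> // i X Y Z W Xs Ys Zs Ws u Uu.
exact: (Pproj4_hcurvature4 (tf i) (vf i) (dev i)).
Qed.
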